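(* Let $\beta\in\mathbb{C}$ with $\beta\notin\mathbb{Z}$ and let $$\phi^{(2,\beta)}(e^{i\theta})=t_{\beta}(e^{i\theta})\,t_{\beta}(e^{i(\theta-\pi)}).$$ Then, as $n\to\infty$, $$\det M_n(\phi^{(2,\beta)})\sim n^{-3\beta^2}\,2^{4\beta^2}\,G(1-2\beta)\,G(1+\beta)^2.$$ Moreover, $\det M_n(\phi^{(2,\beta)})=0$ if and only if $\beta\in\{1/2,3/2,5/2,\dots\}$ and $n\ge 2\beta+1$.
   Context: $\phi_k=\frac1{2\pi}\int_0^{2\pi}\phi(e^{i\theta})e^{-ik\theta}d\theta$ is the $k$-th Fourier coefficient, and $M_n(\phi)=(\phi_{j-k}+\phi_{j+k+1})_{j,k=0}^{n-1}$. For $\beta\in\mathbb{C}$, $t_\beta(e^{i\theta})=\exp(i\beta(\theta-\pi))$ for $0<\theta<2\pi$; $t_\beta(e^{i(\theta-\pi)})$ is the value of $t_\beta$ at the point $e^{i(\theta-\pi)}$. $G(\cdot)$ is the Barnes G-function, $G(1+z)=(2\pi)^{z/2}e^{-(z+1)z/2-\gamma_E z^2/2}\prod_{k=1}^\infty\left((1+z/k)^k e^{-z+z^2/(2k)}\right)$, with $\gamma_E$ Euler's constant. $a_n\sim c_n$ means $a_n=c_n(1+o(1))$ as $n\to\infty$ (so if $c_n=0$ for all $n$, then $a_n=0$ for all large $n$). *)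

(* Defs.v *)
From mathcomp Require Import all_boot all_order all_algebra.
From mathcomp Require Import all_classical all_reals all_analysis.
From mathcomp Require Export complex.
From mathcomp Require Import ring lra.

Set Implicit Arguments.
Unset Strict Implicit.
Unset Printing Implicit Defensive.

Import Order.TTheory GRing.Theory Num.Theory.
Import numFieldNormedType.Exports.

Local Open Scope classical_set_scope.
Local Open Scope ring_scope.
Local Open Scope complex_scope.

Section Defs.
Context {R : realType}.

Definition cexp (z : R[i]) : R[i] :=
  (expR (complex.Re z) * cos (complex.Im z)) +i* (expR (complex.Re z) * sin (complex.Im z)).

Definition expi (theta : R) : R[i] := cexp ('i%C * theta%:C).

(* Meaningful only for [0 < x]. *)
Definition rpowc (x : R) (s : R[i]) : R[i] := cexp (s * (ln x)%:C).

Definition cintegral (a b : R) (f : R -> R[i]) : R[i] :=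
  (\int[lebesgue_measure]_(x in `[a, b]) complex.Re (f x)) +i*
  (\int[lebesgue_measure]_(x in `[a, b]) complex.Im (f x)).

Definition fourier (phi : R[i] -> R[i]) (k : int) : R[i] :=
  (2 * pi)^-1%:C *
  cintegral 0 (2 * pi) (fun theta => phi (expi theta) * expi (- (k%:~R * theta))).

Definition M (n : nat) (phi : R[i] -> R[i]) : 'M[R[i]]_n :=
  \matrix_(j < n, k < n)
    (fourier phi (j%:Z - k%:Z) + fourier phi (j%:Z + k%:Z + 1)).

(* The argument in ]0, 2 pi[ of a point of the unit circle other than 1. The
   default value 0 is taken at 1, where [t_ beta] is left unspecified on paper;
   a single point does not affect Fourier coefficients. *)
Definition angle (z : R[i]) : R :=
  xget 0 [set theta | 0 < theta < 2 * pi /\ expi theta = z].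

Definition t_ (beta z : R[i]) : R[i] :=
  cexp ('i%C * beta * (angle z - pi)%:C).

(* As a function of the point [z = e^(i theta)]: [e^(i (theta - pi))] is
   [z * e^(- i pi)], see [phi2E]. *)
Definition phi2 (beta z : R[i]) : R[i] := t_ beta z * t_ beta (z * expi (- pi)).

Definition euler_gamma : R :=
  limn (fun n : nat => \sum_(1 <= k < n.+1) k%:R^-1 - ln n%:R : R).

Definition barnesG1p (z : R[i]) : R[i] :=
  rpowc (2 * pi) (z / 2) *
  cexp (- ((z + 1) * z / 2) - euler_gamma%:C * z ^+ 2 / 2) *
  limn (fun n : nat => \prod_(1 <= k < n.+1)
          ((1 + z / k%:R) ^+ k * cexp (- z + z ^+ 2 / (2 * k%:R))) : R[i]^o).

Definition barnesG (w : R[i]) : R[i] := barnesG1p (w - 1).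

(* a_n = c_n (1 + o(1)); [c] may vanish. *)
Definition asymp (a c : nat -> R[i]) : Prop :=
  exists r : nat -> R[i]^o,
    r @ \oo --> (0 : R[i]^o) /\ \forall n \near \oo, a n = c n * (1 + r n).

Lemma expiE (theta : R) : expi theta = cos theta +i* sin theta.
Proof.
by rewrite /expi /cexp /= !mul0r !mulr0 !mul1r subr0 add0r expR0 !mul1r.
Qed.

Lemma expiD (x y : R) : expi (x + y) = expi x * expi y.
Proof.
rewrite !expiE cosD sinD; apply/eqP; rewrite eq_complex /= eqxx /=.
by rewrite addrC.
Qed.

Lemma expi_inj (x y : R) : 0 < x < 2 * pi -> 0 < y < 2 * pi ->
  expi x = expi y -> x = y.
Proof.
wlog lexy : x y / x <= y.
  move=> W hx hy e; have [h|/ltW h] := leP x y; first exact: W.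
  by apply/esym/W.
move=> /andP[x0 x1] /andP[y0 y1]; rewrite !expiE => -[ec es].
apply/eqP; rewrite eq_le lexy leNgt; apply/negP => ltxy.
have : 0 < sin ((y - x) / 2) by apply: sin_gt0_pi; lra.
have c1 : cos (y - x) = 1.
  by rewrite cosB ec es -!expr2 cos2Dsin2.
have : cos (y - x) = 1 - 2 * sin ((y - x) / 2) ^+ 2.
  have {1}-> : y - x = (y - x) / 2 + (y - x) / 2 by lra.
  rewrite cosD; have := cos2Dsin2 ((y - x) / 2); lra.
rewrite c1 => h s0.
have : 0 < sin ((y - x) / 2) ^+ 2 by rewrite exprn_gt0.
lra.
Qed.

Lemma angleE (theta : R) : 0 < theta < 2 * pi -> angle (expi theta) = theta.
Proof.
move=> h; rewrite /angle.
have [x _ [hx e] | /(_ theta) []] := xgetP; last by split.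
exact: expi_inj hx h e.
Qed.

Lemma t_E (beta : R[i]) (theta : R) : 0 < theta < 2 * pi ->
  t_ beta (expi theta) = cexp ('i%C * beta * (theta - pi)%:C).
Proof. by move=> h; rewrite /t_ angleE. Qed.

Lemma phi2E (beta : R[i]) (theta : R) :
  phi2 beta (expi theta) = t_ beta (expi theta) * t_ beta (expi (theta - pi)).
Proof. by rewrite /phi2 expiD. Qed.

End Defs.

(* Main.v *)
Require Import Defs.
From mathcomp Require Import all_boot all_order all_algebra.
From mathcomp Require Import all_classical all_reals all_analysis.
From mathcomp Require Import measurable_realfun zify ring lra.

(** The symbol is [t_ beta] evaluated at the square of the point, so its odd
Fourier coefficients vanish and the one of index [2m] is [c / (beta - m)] with
[c = sin (pi beta) / pi].  In the matrix exactly one of the two summands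
survives, according to the parity of [j - k]; attaching to an even index [2p]
the node [p] and to an odd index [2p+1] the node [-(p+1)] turns the matrix, up
to signs of rows, into a Cauchy matrix ([M_phi2_entry]).

The Schur complement of the last entry of a Cauchy matrix is again a Cauchy
matrix, with rescaled rows and columns ([det_cauchy_rec]).  Hence the quotient
of two consecutive determinants is explicit ([det_M_phi2_rec]): with
[N = n / 2], it is
  [c / beta / \prod_(m <= N) (1 - beta^2 / m^2)] times
  [\prod_(N < m <= n) (1 - 2 beta / m) / (1 - beta / m)^2].
Only the numerators [1 - 2 beta / m] can vanish, and the one of index [m] is
present from size [m + 1] on, which gives the zeros; [2 beta] being a positive
integer while [beta] is not an integer makes [beta] a half-integer.

For the asymptotics, write [T_N] for the first quotient above.  The product
formula for the sine says that [T_N] is the tail of that product; the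
expansion [T_N = 1 - beta^2 / (N + 1) + O(1 / N^2)] is proved directly, because
[T_N] is exactly the ratio of the integrals over [0, pi/2] of
[cos t ^ 2N cos (2 beta t)] and of [cos t ^ 2N] ([wallis_sine_tail]):
they obey the recurrences [(n^2 - w^2) I_n = n (n - 1) I_{n-2}] with [w = 2 beta]
and [w = 0], and
[cos (2 beta t) = 1 - 2 beta^2 sin^2 t + O(sin^4 t)].

In size [2N] the factors combine ([det_M_phi2_double]) into [T_N ^ 2N], the
partial Barnes products at [- 2 beta] and (twice) at [beta], and a product over
[N < m <= 2N].  The Barnes products converge, and the other two factors tend
to one when multiplied by explicit exponentials.  The exponents left over are
harmonic sums, whose limit brings in Euler's constant and [ln 2]
([cvg_exponent_seq]).  Odd sizes differ by one factor tending to one.  The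
powers of [2 pi] in the three Barnes functions cancel.  The limit of the
normalised determinant is zero only if a factor of the Barnes product at
[- 2 beta] is, and then the determinant itself is eventually zero. *)

Set Implicit Arguments.
Unset Strict Implicit.
Unset Printing Implicit Defensive.

Import Order.TTheory GRing.Theory Num.Theory.
Import numFieldNormedType.Exports.

Local Open Scope classical_set_scope.
Local Open Scope ring_scope.
Local Open Scope complex_scope.

(** * The modulus and the exponential on complex numbers *)

(* The norm of the complex numbers as a normed ring takes complex values; the
   real-valued modulus is the one on which real arithmetic can be used. *)
Local Notation cabs := Normc.normc.

Section Modulus.
Context {R : realType}.
Implicit Types z w : R[i].

Lemma normC_cabs z : `|z| = (cabs z)%:C.
Proof. by []. Qed.

Lemma cabs_ge0 z : 0 <= cabs z.
Proof. by case: z => a b; rewrite /= sqrtr_ge0. Qed.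

Lemma cabsD z w : cabs (z + w) <= cabs z + cabs w.
Proof. exact: le_normcD. Qed.

Lemma cabsN z : cabs (- z) = cabs z.
Proof. exact: normcN. Qed.

Lemma cabsB z w : cabs (z - w) <= cabs z + cabs w.
Proof. by rewrite -[cabs w]cabsN cabsD. Qed.

Lemma cabsM z w : cabs (z * w) = cabs z * cabs w.
Proof. exact: Normc.normcM. Qed.

Lemma cabsV z : cabs z^-1 = (cabs z)^-1.
Proof. exact: Normc.normcV. Qed.

Lemma cabs0 : cabs (0 : R[i]) = 0.
Proof. exact: Normc.normc0. Qed.

Lemma cabs1 : cabs (1 : R[i]) = 1.
Proof. exact: Normc.normc1. Qed.

Lemma cabsX z n : cabs (z ^+ n) = cabs z ^+ n.
Proof.
by elim: n => [|n IH]; rewrite ?expr0 ?cabs1// !exprS cabsM IH.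
Qed.

Lemma cabs_real (x : R) : cabs x%:C = `|x|.
Proof. by rewrite /= expr0n/= addr0 sqrtr_sqr. Qed.

Lemma cabs_nat n : cabs (n%:R : R[i]) = n%:R.
Proof. by rewrite -(rmorph_nat (real_complex R)) cabs_real normr_nat. Qed.

Lemma cabs_eq0 z : (cabs z == 0) = (z == 0).
Proof.
by apply/eqP/eqP => [/Normc.eq0_normc//|->]; rewrite cabs0.
Qed.

Lemma cabs_gt0 z : (0 < cabs z) = (z != 0).
Proof. by rewrite lt0r cabs_ge0 andbT cabs_eq0. Qed.

Lemma Re_le_cabs z : `|complex.Re z| <= cabs z.
Proof. by have := normc_ge_Re z; rewrite normC_cabs lecR. Qed.

Lemma cabs_i : cabs ('i%C : R[i]) = 1.
Proof. by rewrite /= expr0n/= expr1n add0r sqrtr1. Qed.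

Lemma Im_le_cabs z : `|complex.Im z| <= cabs z.
Proof.
have := Re_le_cabs (z * 'i%C).
by rewrite ReiNIm normrN cabsM cabs_i mulr1.
Qed.

Lemma cabs_le_ReIm z : cabs z <= `|complex.Re z| + `|complex.Im z|.
Proof.
rewrite {1}[z]complexE; apply: (le_trans (cabsD _ _)).
by rewrite cabsM cabs_i mul1r !cabs_real.
Qed.

End Modulus.

Section Exponential.
Context {R : realType}.
Implicit Types z w : R[i].

Lemma cexpD z w : cexp (z + w) = cexp z * cexp w.
Proof.
case: z w => [a b] [c d]; rewrite /cexp /= expRD sinD cosD.
by apply/eqP; rewrite eq_complex /=; apply/andP; split; apply/eqP; ring.
Qed.

Lemma cexp0 : cexp (0 : R[i]) = 1.
Proof. by rewrite /cexp /= expR0 cos0 sin0 !mul1r. Qed.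

Lemma cexpNM z : cexp (- z) * cexp z = 1.
Proof. by rewrite -cexpD addNr cexp0. Qed.

Lemma cexp_neq0 z : cexp z != 0.
Proof.
by apply/eqP => e; have := cexpNM z; rewrite e mulr0 => /eqP; rewrite eq_sym oner_eq0.
Qed.

Lemma cexpN z : cexp (- z) = (cexp z)^-1.
Proof. by rewrite -[LHS]mulr1 -(divff (cexp_neq0 z)) mulrA cexpNM mul1r. Qed.

Lemma cexpMn z n : cexp (z *+ n) = cexp z ^+ n.
Proof.
elim: n => [|n IH]; first by rewrite mulr0n expr0 cexp0.
by rewrite mulrS cexpD IH exprS.
Qed.

Lemma cexp_sum (I : Type) (r : seq I) (P : pred I) (F : I -> R[i]) :
  cexp (\sum_(i <- r | P i) F i) = \prod_(i <- r | P i) cexp (F i).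
Proof. by apply: big_morph; [exact: cexpD | exact: cexp0]. Qed.

Lemma cabs_cexp z : cabs (cexp z) = expR (complex.Re z).
Proof.
case: z => a b /=; rewrite !exprMn -mulrDr cos2Dsin2 mulr1 sqrtr_sqr.
by rewrite ger0_norm// expR_ge0.
Qed.

Lemma cabs_cexp_le z : cabs (cexp z) <= expR (cabs z).
Proof.
by rewrite cabs_cexp ler_expR (le_trans (ler_norm _))// Re_le_cabs.
Qed.

End Exponential.

(** * Derivatives of complex-valued functions of a real variable *)

Section CDerive.
Context {R : realType}.
Implicit Types (f g : R -> R[i]) (t : R) (d e w : R[i]).

(** Stated on real and imaginary parts, because the complex numbers are a
normed module over themselves and not over the reals. *)
Definition is_cderive t f d :=
  is_derive t 1 (fun s => complex.Re (f s)) (complex.Re d) /\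
  is_derive t 1 (fun s => complex.Im (f s)) (complex.Im d).

Lemma is_cderive_eq t f d e : is_cderive t f d -> d = e -> is_cderive t f e.
Proof. by move=> + <-. Qed.

Lemma is_cderive_ext t f g d : (forall s, f s = g s) -> is_cderive t f d ->
  is_cderive t g d.
Proof. by move=> /funext ->. Qed.

Lemma is_cderive_cst t w : is_cderive t (fun=> w) 0.
Proof. by split; exact: is_derive_cst. Qed.

Lemma is_cderive_real t (u : R -> R) (du : R) : is_derive t 1 u du ->
  is_cderive t (fun s => (u s)%:C) du%:C.
Proof. by move=> du'; split => //=; exact: is_derive_cst. Qed.

Lemma Re_addC z w : complex.Re (z + w) = complex.Re z + complex.Re w :> R.
Proof. by case: z w => [? ?] [? ?]. Qed.
Lemma Im_addC z w : complex.Im (z + w) = complex.Im z + complex.Im w :> R.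
Proof. by case: z w => [? ?] [? ?]. Qed.
Lemma Re_mulC z w : complex.Re (z * w) =
  complex.Re z * complex.Re w - complex.Im z * complex.Im w :> R.
Proof. by case: z w => [? ?] [? ?]. Qed.
Lemma Im_mulC z w : complex.Im (z * w) =
  complex.Re z * complex.Im w + complex.Im z * complex.Re w :> R.
Proof. by case: z w => [? ?] [? ?]. Qed.

Lemma is_cderiveD t f g d e : is_cderive t f d -> is_cderive t g e ->
  is_cderive t (fun s => f s + g s) (d + e).
Proof.
move=> [? ?] [? ?]; split.
  by under [fun s => _]eq_fun do rewrite Re_addC; rewrite Re_addC; exact: is_deriveD.
by under [fun s => _]eq_fun do rewrite Im_addC; rewrite Im_addC; exact: is_deriveD.
Qed.

Lemma is_cderiveM t f g d e : is_cderive t f d -> is_cderive t g e ->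
  is_cderive t (fun s => f s * g s) (d * g t + f t * e).
Proof.
move=> [? ?] [? ?]; split.
  under [fun s => _]eq_fun do rewrite Re_mulC.
  apply: is_derive_eq; rewrite Re_addC !Re_mulC /GRing.scale /=; ring.
under [fun s => _]eq_fun do rewrite Im_mulC.
apply: is_derive_eq; rewrite Im_addC !Im_mulC /GRing.scale /=; ring.
Qed.

Lemma is_cderiveMl t f d w : is_cderive t f d ->
  is_cderive t (fun s => w * f s) (w * d).
Proof.
move=> df; apply: is_cderive_eq (is_cderiveM (is_cderive_cst t w) df) _.
by rewrite mul0r add0r.
Qed.

Lemma is_cderiveX t f d n : is_cderive t f d ->
  is_cderive t (fun s => f s ^+ n) (n%:R * f t ^+ n.-1 * d).
Proof.
move=> df; elim: n => [|n IH].
  apply: is_cderive_eq; last by rewrite !mul0r.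
  exact: is_cderive_cst.
apply: (@is_cderive_ext _ (fun s => f s * f s ^+ n)).
  by move=> s; rewrite exprS.
apply: is_cderive_eq (is_cderiveM df IH) _ => /=.
by case: n {IH} => [|n] /=; rewrite ?expr0 1?exprS -?(natr1 _ n.+1); ring.
Qed.

Lemma is_cderive_cexp t f d : is_cderive t f d ->
  is_cderive t (fun s => cexp (f s)) (d * cexp (f t)).
Proof.
move=> [dR dI]; split; rewrite /cexp /=.
  apply: is_derive_eq; rewrite Re_mulC /GRing.scale /=; ring.
apply: is_derive_eq; rewrite Im_mulC /GRing.scale /=; ring.
Qed.

End CDerive.

(** * Mean value bound and fundamental theorem of calculus *)

Section RealFTC.
Context {R : realType}.
Implicit Types (f F : R -> R) (a b c : R).
Local Notation mu := (@lebesgue_measure R).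

Lemma is_derive1_continuous f df :
  (forall t : R, is_derive t (1 : R) f (df t)) -> continuous f.
Proof.
by move=> h t; apply/differentiable_continuous/derivable1_diffP; exact: ex_derive.
Qed.

Lemma continuous_within_segment f a b :
  continuous f -> {within `[a, b], continuous f}.
Proof. by move=> h; apply: continuous_subspaceT. Qed.

Lemma continuous_segment_integrable f a b :
  continuous f -> mu.-integrable `[a, b] (EFin \o f).
Proof.
move=> h; apply: continuous_compact_integrable; first exact: segment_compact.
exact: continuous_within_segment.
Qed.

Lemma integral_derive F f a b : a < b -> continuous f ->
  (forall t : R, is_derive t (1 : R) F (f t)) ->
  (\int[mu]_(x in `[a, b]) (f x)%:E)%E = (F b - F a)%:E.
Proof.
move=> ab cf dF; have cF := is_derive1_continuous dF.
rewrite (@continuous_FTC2 _ f F a b)//.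
- exact: continuous_within_segment.
- split => [x _||]; first exact: ex_derive.
    by apply: cvg_at_right_filter; exact: cF.
  by apply: cvg_at_left_filter; exact: cF.
- by move=> x _; rewrite derive1E derive_val.
Qed.

(** The values at the three break points are left free: the symbol is only
known away from its jumps. *)
Lemma Rintegral_derive_pieces f f1 f2 F1 F2 a c b : a < c < b ->
  continuous f1 -> continuous f2 ->
  (forall t : R, is_derive t (1 : R) F1 (f1 t)) ->
  (forall t : R, is_derive t (1 : R) F2 (f2 t)) ->
  (forall t, a < t < c -> f t = f1 t) -> (forall t, c < t < b -> f t = f2 t) ->
  \int[mu]_(x in `[a, b]) f x = (F1 c - F1 a) + (F2 b - F2 c).
Proof.
move=> /andP[ac cb] cf1 cf2 dF1 dF2 e1 e2.
have m1 : measurable_fun `]a, c[ f.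
  apply: (@eq_measurable_fun _ _ _ _ _ f1).
    by move=> t; rewrite inE/= in_itv/= => /e1.
  by apply: measurable_funTS; exact: continuous_measurable_fun.
have m2 : measurable_fun `]c, b[ f.
  apply: (@eq_measurable_fun _ _ _ _ _ f2).
    by move=> t; rewrite inE/= in_itv/= => /e2.
  by apply: measurable_funTS; exact: continuous_measurable_fun.
have i1 : (\int[mu]_(x in `[a, c]) (f x)%:E)%E = (F1 c - F1 a)%:E.
  rewrite -(integral_derive ac cf1 dF1).
  rewrite [RHS]integral_itv_bndoo; last first.
    by apply/measurable_EFinP; apply: measurable_funTS; exact: continuous_measurable_fun.
  rewrite integral_itv_bndoo; last exact/measurable_EFinP.
  apply: eq_integral => t.
  by rewrite inE/= in_itv/= => /e1 ->.
have i2 : (\int[mu]_(x in `]c, b]) (f x)%:E)%E = (F2 b - F2 c)%:E.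
  rewrite -(integral_derive cb cf2 dF2).
  rewrite [RHS]integral_itv_bndoo; last first.
    by apply/measurable_EFinP; apply: measurable_funTS; exact: continuous_measurable_fun.
  rewrite integral_itv_bndoo; last exact/measurable_EFinP.
  apply: eq_integral => t.
  by rewrite inE/= in_itv/= => /e2 ->.
rewrite /Rintegral (@itv_bndbnd_setU _ _ _ (BRight c)); last 2 first.
- by rewrite bnd_simp ltW.
- by rewrite bnd_simp ltW.
rewrite integral_setU//=.
- by rewrite i1 i2.
- apply/measurable_funU => //; split; last first.
    by apply/measurable_EFinP; apply: measurable_fun_itv_oc m2.
  by apply/measurable_EFinP; apply: measurable_fun_itv_cc m1.
- apply/disj_setPS => y [/=]; rewrite 2!in_itv/= => /andP[_ yx] /andP[].
  by rewrite ltNge yx.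
Qed.

End RealFTC.

Section ComplexCalculus.
Context {R : realType}.
Implicit Types (f F : R -> R[i]) (a b c C t : R).

(** The factor 2 comes from treating real and imaginary parts separately. *)
Lemma cabs_increment_le f df C a b : a <= b ->
  (forall t, is_cderive t f (df t)) ->
  (forall t, a <= t <= b -> cabs (df t) <= C) ->
  cabs (f b - f a) <= 2 * C * (b - a).
Proof.
move=> ab dfE dfC.
have half (u du : R -> R) : (forall t, is_derive t (1 : R) u (du t)) ->
    (forall t, `|du t| <= cabs (df t)) -> `|u b - u a| <= C * (b - a).
  move=> du' le_du.
  have cu := continuous_within_segment (a := a) (b := b) (is_derive1_continuous du').
  have [t] := MVT_segment ab (fun t _ => du' t) cu.
  rewrite in_itv/= => tab ->; rewrite normrM [`|b - a|]ger0_norm ?subr_ge0//.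
  by rewrite ler_wpM2r ?subr_ge0// (le_trans (le_du t))// dfC.
apply: (le_trans (cabs_le_ReIm _)).
rewrite !raddfB /=.
have hR := half _ _ (fun t => (dfE t).1) (fun t => Re_le_cabs _).
have hI := half _ _ (fun t => (dfE t).2) (fun t => Im_le_cabs _).
have -> : 2 * C * (b - a) = C * (b - a) + C * (b - a) by ring.
exact: lerD.
Qed.

Lemma cintegral_derive_pieces f f1 f2 F1 F2 df1 df2 a c b : a < c < b ->
  (forall t, is_cderive t F1 (f1 t)) -> (forall t, is_cderive t f1 (df1 t)) ->
  (forall t, is_cderive t F2 (f2 t)) -> (forall t, is_cderive t f2 (df2 t)) ->
  (forall t, a < t < c -> f t = f1 t) -> (forall t, c < t < b -> f t = f2 t) ->
  cintegral a b f = (F1 c - F1 a) + (F2 b - F2 c).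
Proof.
move=> acb dF1 d1 dF2 d2 e1 e2.
apply/eqP; rewrite eq_complex /= !raddfD !raddfN /=; apply/andP; split; apply/eqP.
  apply: (Rintegral_derive_pieces acb (is_derive1_continuous (fun t => (d1 t).1))
    (is_derive1_continuous (fun t => (d2 t).1)) (fun t => (dF1 t).1)
    (fun t => (dF2 t).1)) => t ht; first by rewrite e1.
  by rewrite e2.
apply: (Rintegral_derive_pieces acb (is_derive1_continuous (fun t => (d1 t).2))
    (is_derive1_continuous (fun t => (d2 t).2)) (fun t => (dF1 t).2)
    (fun t => (dF2 t).2)) => t ht; first by rewrite e1.
by rewrite e2.
Qed.

End ComplexCalculus.

(** * Estimates on exponentials and products *)

Section ExpBounds.
Context {R : realType}.
Implicit Types z w : R[i].

Lemma cabs_cexp_sub1 z : cabs (cexp z - 1) <= 2 * (cabs z * expR (cabs z)).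
Proof.
pose f t := cexp (t%:C * z); pose df t := z * cexp (t%:C * z).
have dfE t : is_cderive t f (df t).
  apply: is_cderive_cexp; apply: is_cderive_eq.
    apply: is_cderiveM (is_cderive_cst _ z).
    by apply: is_cderive_real; exact: is_derive_id.
  by rewrite mulr0 addr0 mul1r.
have := @cabs_increment_le _ f df (cabs z * expR (cabs z)) 0 1 ler01 dfE.
rewrite /f mul1r mul0r cexp0 subr0 mulr1; apply => t /andP[t0 t1].
rewrite /df cabsM ler_wpM2l ?cabs_ge0// (le_trans (cabs_cexp_le _))//.
by rewrite ler_expR cabsM cabs_real ger0_norm// ler_piMl ?cabs_ge0.
Qed.

(** Along the segment from 0 to [w] the derivative of
[(1 + t w) exp (- t w + t^2 w^2 / 2)] collapses to [t^2 w^3] times the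
exponential: this is the cubic remainder of the logarithm, without choosing a
branch. *)
Lemma cabs_weierstrass_factor w :
  cabs ((1 + w) * cexp (- w + w ^+ 2 / 2) - 1) <=
  2 * (cabs w ^+ 3 * expR (cabs w + cabs w ^+ 2)).
Proof.
pose f t := (1 + w * t%:C) * cexp (- w * t%:C + w ^+ 2 / 2 * t%:C ^+ 2).
pose df t := (t%:C ^+ 2 * w ^+ 3) * cexp (- w * t%:C + w ^+ 2 / 2 * t%:C ^+ 2).
have dtE t : is_cderive t (fun s => s%:C) (1 : R[i]).
  by apply: is_cderive_real; exact: is_derive_id.
have dfE t : is_cderive t f (df t).
  apply: is_cderive_eq.
    apply: is_cderiveM.
      apply: is_cderiveD (is_cderive_cst _ _) (is_cderiveMl _ (dtE t)).
    apply: is_cderive_cexp; apply: is_cderiveD (is_cderiveMl _ (dtE t)) _.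
    by apply: is_cderiveMl; apply: is_cderiveX; exact: dtE.
  rewrite /df /= add0r !mulr1 expr1; set E := cexp _.
  have -> : w ^+ 2 / 2 * (2%:R * t%:C) = w ^+ 2 * t%:C by field.
  by ring.
have := @cabs_increment_le _ f df
  (cabs w ^+ 3 * expR (cabs w + cabs w ^+ 2)) 0 1 ler01 dfE.
rewrite /f expr1n !mulr1 subr0 mulr1 expr0n !mulr0 !addr0 cexp0 mulr1.
apply => t /andP[t0 t1].
rewrite /df cabsM ler_pM ?cabs_ge0//.
  rewrite cabsM !cabsX cabs_real ger0_norm// ler_piMl ?exprn_ge0 ?cabs_ge0//.
  by rewrite expr_le1.
rewrite (le_trans (cabs_cexp_le _))// ler_expR (le_trans (cabsD _ _))//.
have -> : cabs (- w * t%:C) = cabs w * t by rewrite cabsM cabsN cabs_real ger0_norm.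
rewrite cabsM [cabs (_ / 2)]cabsM !cabsX cabs_real ger0_norm// lerD//.
  by rewrite ler_piMr ?cabs_ge0.
have h2 : cabs (2^-1 : R[i]) = 2^-1 by rewrite cabsV cabs_nat.
rewrite h2 -mulrA ler_piMr ?exprn_ge0 ?cabs_ge0//.
have : t ^+ 2 <= 1 by rewrite expr_le1.
by lra.
Qed.

Lemma expR_sub1_le (x : R) : 0 <= x -> expR x - 1 <= x * expR x.
Proof.
move=> x0; have := expR_ge1Dx (- x); rewrite expRN.
have e0 := expR_gt0 x.
by rewrite -(ler_pM2r e0) mulVf ?gt_eqF//; lra.
Qed.

(** Expanding the product, every term is dominated by the corresponding term of
the product of the [1 + cabs (u i - 1)]. *)
Lemma cabs_prod_sub1_le (I : Type) (r : seq I) (P : pred I) (u : I -> R[i]) :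
  cabs (\prod_(i <- r | P i) u i - 1) <=
  expR (\sum_(i <- r | P i) cabs (u i - 1)) - 1.
Proof.
elim/big_rec2: _ => [|i s p _ IH].
  by rewrite subrr cabs0 expR0 subrr.
have -> : u i * p - 1 = (u i - 1) * (p - 1) + (u i - 1) + (p - 1) by ring.
have h1 := cabsD ((u i - 1) * (p - 1) + (u i - 1)) (p - 1).
have h2 := cabsD ((u i - 1) * (p - 1)) (u i - 1).
rewrite cabsM in h2.
have d0 := cabs_ge0 (u i - 1); have p0 := cabs_ge0 (p - 1).
rewrite expRD; have := expR_ge1Dx (cabs (u i - 1)).
set d := cabs (u i - 1) in h1 h2 d0 *; set q := cabs (p - 1) in h1 h2 p0 IH *.
move=> hd; have : (1 + d) * (1 + q) <= expR d * expR s.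
  by apply: ler_pM; lra.
by lra.
Qed.

Lemma cabs_prod_le (I : Type) (r : seq I) (P : pred I) (u : I -> R[i]) :
  cabs (\prod_(i <- r | P i) u i) <= expR (\sum_(i <- r | P i) cabs (u i - 1)).
Proof.
have h := cabs_prod_sub1_le r P u.
have := cabsD (\prod_(i <- r | P i) u i - 1) 1; rewrite subrK cabs1; lra.
Qed.

Lemma cabs_exp_sub1_le z n :
  cabs (z ^+ n - 1) <= expR (n%:R * cabs (z - 1)) - 1.
Proof.
have := cabs_prod_sub1_le (index_iota 0 n) xpredT (fun=> z).
by rewrite prodr_const_nat sumr_const_nat subn0 mulr_natl.
Qed.

End ExpBounds.

Section ComplexLimits.
Context {R : realType}.
Implicit Types (u v : nat -> R[i]^o) (l w : R[i]^o).

Lemma cvg_cabs0 u l :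
  (fun n => cabs (u n - l)) @ \oo --> (0 : R) -> u @ \oo --> l.
Proof.
move=> /cvgrPdist_lt h; apply/cvgrPdist_lt => e e0.
have ee : e = (complex.Re e)%:C by rewrite RRe_real// gtr0_real.
have e0' : 0 < complex.Re e by move: e0; rewrite ee ltcR.
near=> n; rewrite distrC ee normC_cabs ltcR.
have : `|0 - cabs (u n - l)| < complex.Re e by near: n; exact: h.
by rewrite sub0r normrN ger0_norm ?cabs_ge0.
Unshelve. all: by end_near. Qed.

Lemma cvg_ReIm u (a b : R) :
  (fun n => complex.Re (u n)) @ \oo --> a ->
  (fun n => complex.Im (u n)) @ \oo --> b -> u @ \oo --> (a +i* b : R[i]^o).
Proof.
move=> ha hb; apply: cvg_cabs0.
apply: (@squeeze_cvgr _ _ _ _ (fun=> 0)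
   (fun n => `|complex.Re (u n) - a| + `|complex.Im (u n) - b|)).
- by near=> n; rewrite cabs_ge0 (le_trans (cabs_le_ReIm _))//; case: (u n).
- exact: cvg_cst.
- rewrite -[0 in X in _ --> X]addr0; apply: cvgD.
    by apply/norm_cvg0P; apply/subr_cvg0.
  by apply/norm_cvg0P; apply/subr_cvg0.
Unshelve. all: by end_near. Qed.

End ComplexLimits.

(** * Sequences tending to one at a given rate, and infinite products *)

Section NearOne.
Context {R : realType}.
Implicit Types (u v : nat -> R[i]) (p : nat).

(** [u n = 1 + O(1 / n ^ p)] *)
Definition near_one p u :=
  exists C : R, \forall n \near \oo, cabs (u n - 1) * n%:R ^+ p <= C.

Lemma near_oneP p u : near_one p u -> exists C : R, 0 <= C /\
  \forall n \near \oo, cabs (u n - 1) <= C / n%:R ^+ p.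
Proof.
move=> [C hC]; exists `|C|; split => //.
near=> n.
have n0 : 0 < n%:R ^+ p :> R.
  by rewrite exprn_gt0// ltr0n; near: n; exact: nbhs_infty_gt.
rewrite ler_pdivlMr//; apply: le_trans (ler_norm C); near: n; exact: hC.
Unshelve. all: by end_near. Qed.

Lemma near_one_le p u (C : R) :
  (\forall n \near \oo, cabs (u n - 1) <= C / n%:R ^+ p) -> near_one p u.
Proof.
move=> hC; exists C; near=> n.
have n0 : 0 < n%:R ^+ p :> R.
  by rewrite exprn_gt0// ltr0n; near: n; exact: nbhs_infty_gt.
by rewrite -ler_pdivlMr//; near: n; exact: hC.
Unshelve. all: by end_near. Qed.

Lemma near_one_ext p u v : (\forall n \near \oo, u n = v n) ->
  near_one p u -> near_one p v.
Proof.
move=> uv [C hC]; exists C; near=> n.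
have <- : u n = v n by near: n.
by near: n.
Unshelve. all: by end_near. Qed.

Lemma near_one_weaken p q u : (q <= p)%N -> near_one p u -> near_one q u.
Proof.
move=> qp [C hC]; exists C; near=> n.
have n1 : 1 <= n%:R :> R by rewrite ler1n; near: n; exact: nbhs_infty_gt.
apply: (@le_trans _ _ (cabs (u n - 1) * n%:R ^+ p)); last by near: n.
by rewrite ler_wpM2l ?cabs_ge0// ler_weXn2l.
Unshelve. all: by end_near. Qed.

Lemma near_oneM p u v : near_one p u -> near_one p v ->
  near_one p (fun n => u n * v n).
Proof.
move=> /near_oneP[C [C0 hC]] /near_oneP[D [D0 hD]].
apply: (@near_one_le _ _ (C + D + C * D)); near=> n.
have n1 : 1 <= n%:R ^+ p :> R.
  by rewrite exprn_ege1// ler1n; near: n; exact: nbhs_infty_gt.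
have hu : cabs (u n - 1) <= C / n%:R ^+ p by near: n.
have hv : cabs (v n - 1) <= D / n%:R ^+ p by near: n.
have -> : u n * v n - 1 = (u n - 1) + (v n - 1) + (u n - 1) * (v n - 1) by ring.
apply: (le_trans (cabsD _ _)); rewrite [leRHS]mulrDl.
apply: lerD; first by rewrite [leRHS]mulrDl (le_trans (cabsD _ _))// lerD.
rewrite cabsM -mulrA; apply: ler_pM; rewrite ?cabs_ge0//.
  by rewrite (le_trans hu)// ler_pdivrMr ?(lt_le_trans ltr01)// ler_peMr.
Unshelve. all: by end_near. Qed.

Lemma near_oneV p u : (0 < p)%N -> near_one p u -> near_one p (fun n => (u n)^-1).
Proof.
move=> p0 /near_oneP[C [C0 hC]].
apply: (@near_one_le _ _ (2 * C)); near=> n.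
have n1 : 1 <= n%:R :> R by rewrite ler1n; near: n; exact: nbhs_infty_gt.
have hu : cabs (u n - 1) <= C / n%:R ^+ p by near: n.
(* Beyond [2 * C] the modulus of [u n] is at least 1/2. *)
have hn : 2 * C <= n%:R by near: n; exact: nbhs_infty_ger.
have np : n%:R <= n%:R ^+ p :> R.
  by rewrite -(prednK p0) exprS ler_peMr ?(le_trans ler01)// exprn_ege1.
have h2 : C / n%:R ^+ p <= 1 / 2.
  by rewrite ler_pdivrMr ?(lt_le_trans ltr01 (le_trans n1 np))//; lra.
have u2 : 1 / 2 <= cabs (u n).
  by have := cabsB (u n) (u n - 1); rewrite opprB addrC subrK cabs1; lra.
have u0 : u n != 0 by rewrite -cabs_gt0; lra.
have -> : (u n)^-1 - 1 = - (u n - 1) / u n by field.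
rewrite cabsM cabsN cabsV.
have h3 : (cabs (u n))^-1 <= 2.
  by rewrite invf_ple ?posrE//; lra.
have -> : 2 * C / n%:R ^+ p = (C / n%:R ^+ p) * 2 by ring.
by apply: ler_pM; rewrite ?invr_ge0 ?cabs_ge0.
Unshelve. all: by end_near. Qed.

(** There are at most [n] factors, and each of them is closer to one than the
product by one power of [n]. *)
Lemma near_one_prod p (r : nat -> seq nat) (w : nat -> nat -> R[i]) (C : R) :
  (forall n, size (r n) <= n)%N ->
  (\forall n \near \oo, forall i, i \in r n -> cabs (w n i - 1) <= C / n%:R ^+ p.+1) ->
  near_one p (fun n => \prod_(i <- r n) w n i).
Proof.
wlog C0 : C / 0 <= C => [W hr hw|hr hw].
  apply: (W `|C|) => //; near=> n => i ri.
  have h : forall i, i \in r n -> cabs (w n i - 1) <= C / n%:R ^+ p.+1 by near: n.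
  apply: (le_trans (h _ ri)).
  by rewrite ler_wpM2r ?invr_ge0 ?exprn_ge0// ler_norm.
apply: (@near_one_le _ _ (C * expR C)); near=> n.
have n1 : 1 <= n%:R :> R by rewrite ler1n; near: n; exact: nbhs_infty_gt.
have n0 : 0 < n%:R :> R by exact: lt_le_trans n1.
have np : 1 <= n%:R ^+ p :> R by rewrite exprn_ege1.
have hn : forall i, i \in r n -> cabs (w n i - 1) <= C / n%:R ^+ p.+1 by near: n.
set s := \sum_(i <- r n) cabs (w n i - 1).
have s0 : 0 <= s by apply: sumr_ge0 => i _; exact: cabs_ge0.
have hs : s <= C / n%:R ^+ p.
  apply: (@le_trans _ _ (\sum_(i <- r n) (C / n%:R ^+ p.+1))).
    by rewrite /s !big_seq; apply: ler_sum => i /hn.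
  rewrite big_const_seq count_predT iter_addr_0 -[_ *+ size _]mulr_natl.
  have -> : C / n%:R ^+ p = n%:R * (C / n%:R ^+ p.+1).
    by rewrite exprS invfM mulrCA mulVKf// gt_eqF.
  by rewrite ler_wpM2r ?ler_nat// divr_ge0// exprn_ge0// ltW.
have hs' : s <= C.
  by rewrite (le_trans hs)// ler_pdivrMr ?(lt_le_trans ltr01)// ler_peMr.
apply: (le_trans (cabs_prod_sub1_le _ _ _)); rewrite -/s.
apply: (le_trans (expR_sub1_le s0)).
by rewrite mulrAC; apply: ler_pM; rewrite ?expR_ge0 ?ler_expR.
Unshelve. all: by end_near. Qed.

(** The exponent costs one power of [n], as would a product of [n] distinct factors. *)
Lemma near_one_expn p u : near_one p.+1 u -> near_one p (fun n => u n ^+ n).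
Proof.
move=> /near_oneP[C [C0 hC]].
have := @near_one_prod p (fun n => index_iota 0 n) (fun n _ => u n) C.
under [X in _ -> _ -> near_one p X]eq_fun do rewrite prodr_const_nat subn0.
apply; first by move=> n; rewrite size_iota subn0.
near=> n => i _; near: n; exact: hC.
Unshelve. all: by end_near. Qed.

Lemma near_one_cvg u : near_one 1 u -> (u : nat -> R[i]^o) @ \oo --> (1 : R[i]^o).
Proof.
move=> /near_oneP[C [C0 hC]]; apply: cvg_cabs0.
apply: (@squeeze_cvgr _ _ _ _ (fun=> 0) (fun n => C * n%:R^-1)).
- by near=> n; rewrite cabs_ge0/= -[n%:R]expr1; near: n.
- exact: cvg_cst.
- rewrite -[0 in X in _ --> X](mulr0 C); apply: cvgMr.
  by apply/gtr0_cvgV0; [near=> n; rewrite ltr0n; near: n; exact: nbhs_infty_gt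
    | exact: cvgr_idn].
Unshelve. all: by end_near. Qed.

(** Lets an additive expansion be used where products of sequences near one are
formed. *)
Lemma near_one_perturb p u v (C : R) : near_one p u ->
  (\forall n \near \oo, cabs (v n - u n) <= C / n%:R ^+ p) -> near_one p v.
Proof.
move=> /near_oneP[D [_ hD]] hC; apply: (@near_one_le _ _ (C + D)); near=> n.
have -> : v n - 1 = (v n - u n) + (u n - 1) by ring.
by rewrite mulrDl (le_trans (cabsD _ _))// lerD//; near: n.
Unshelve. all: by end_near. Qed.

Lemma near_one_cexp p (z : nat -> R[i]) (B : R) :
  (\forall n \near \oo, cabs (z n) <= B / n%:R ^+ p) -> near_one p (fun n => cexp (z n)).
Proof.
move=> hB; apply: (@near_one_le _ _ (2 * (B * expR B))); near=> n.
have n1 : 1 <= n%:R ^+ p :> R.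
  by rewrite exprn_ege1// ler1n; near: n; exact: nbhs_infty_gt.
have hz : cabs (z n) <= B / n%:R ^+ p by near: n.
have B0 : 0 <= B.
  by have := le_trans (cabs_ge0 _) hz; rewrite pmulr_lge0// invr_gt0 (lt_le_trans ltr01).
have hz' : cabs (z n) <= B.
  by rewrite (le_trans hz)// ler_pdivrMr ?(lt_le_trans ltr01)// ler_peMr.
apply: (le_trans (cabs_cexp_sub1 _)); rewrite -mulrA ler_wpM2l//.
by rewrite mulrAC; apply: ler_pM; rewrite ?expR_ge0 ?cabs_ge0 ?ler_expR.
Unshelve. all: by end_near. Qed.

Lemma near_one_weierstrass (z : nat -> R[i]) (B : R) :
  (\forall n \near \oo, cabs (z n) <= B / n%:R) ->
  near_one 3 (fun n => (1 + z n) * cexp (- z n + z n ^+ 2 / 2)).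
Proof.
move=> hB; apply: (@near_one_le _ _ (2 * (B ^+ 3 * expR (B + B ^+ 2)))); near=> n.
have n1 : 1 <= n%:R :> R by rewrite ler1n; near: n; exact: nbhs_infty_gt.
have hz : cabs (z n) <= B / n%:R by near: n.
have B0 : 0 <= B.
  by have := le_trans (cabs_ge0 _) hz; rewrite pmulr_lge0// invr_gt0 (lt_le_trans ltr01).
have hz' : cabs (z n) <= B.
  by rewrite (le_trans hz)// ler_pdivrMr ?(lt_le_trans ltr01)// ler_peMr.
apply: (le_trans (cabs_weierstrass_factor _)); rewrite -mulrA ler_wpM2l//.
rewrite [leRHS]mulrAC -expr_div_n; apply: ler_pM; rewrite ?expR_ge0 ?exprn_ge0 ?cabs_ge0//.
  by rewrite lerXn2r// nnegrE ?cabs_ge0// (le_trans (cabs_ge0 _) hz).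
by rewrite ler_expR lerD// lerXn2r// nnegrE cabs_ge0.
Unshelve. all: by end_near. Qed.

End NearOne.

Section InfiniteProducts.
Context {R : realType}.
Implicit Types u : nat -> R[i].

(** Both [a n - K / n] and [a n + K / n] are monotone. *)
Lemma cvg_of_increments (a : nat -> R) (K : R) :
  (\forall n \near \oo, `|a n.+1 - a n| <= K * (n%:R^-1 - n.+1%:R^-1)) -> cvgn a.
Proof.
move=> [n0 _ h].
pose m := n0.+1.
have hm n : `|a (n.+1 + m)%N - a (n + m)%N| <= K * ((n + m)%:R^-1 - (n.+1 + m)%:R^-1).
  by rewrite addSn; apply: h; rewrite /= /m; lia.
pose x n := a (n + m)%N - K * (n + m)%:R^-1.
have bnd n : a (n + m)%N + K * (n + m)%:R^-1 <= a m + K * m%:R^-1.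
  elim: n => [|n IH]; first by rewrite add0n.
  by apply: le_trans IH; have := hm n; rewrite ler_norml => /andP[]; lra.
have K0 : 0 <= K.
  have := le_trans (normr_ge0 _) (hm 0%N).
  rewrite pmulr_lge0// subr_gt0 ltf_pV2 ?posrE ?ltr0n ?ltr_nat//; rewrite /m; lia.
have cx : cvgn x.
  apply: nondecreasing_is_cvgn.
    apply/nondecreasing_seqP => n.
    by rewrite /x; have := hm n; rewrite ler_norml => /andP[]; lra.
  exists (a m + K * m%:R^-1) => _ [n _ <-]; rewrite /x.
  have : 0 <= K * (n + m)%:R^-1 by rewrite mulr_ge0 ?invr_ge0.
  by have := bnd n; lra.
have cK : (fun n => K * (n + m)%:R^-1) @ \oo --> (0 : R).
  rewrite -[0 in X in _ --> X](mulr0 K); apply: cvgMr.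
  apply/gtr0_cvgV0; first by near=> n; rewrite ltr0n /m; lia.
  by have := @cvgr_idn R; rewrite -(cvg_shiftn m).
suff : cvgn (fun n => a (n + m)%N).
  move=> /cvg_ex[l hl]; apply/cvg_ex; exists l.
  by rewrite -(cvg_shiftn m).
have -> : (fun n => a (n + m)%N) = (fun n => x n + K * (n + m)%:R^-1).
  by apply/funext => n; rewrite /x subrK.
by apply: is_cvgD => //; apply/cvg_ex; exists 0.
Unshelve. all: by end_near. Qed.

(** The partial products are bounded, so that their increments are summable like
those of the sum of the [cabs (u k - 1)]. *)
Lemma near_one2_cvg u : near_one 2 u ->
  exists l : R[i]^o, (fun n => \prod_(1 <= k < n.+1) u k : R[i]^o) @ \oo --> l.
Proof.
move=> /near_oneP[C [C0 hC]].
have inc : \forall n \near \oo,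
    cabs (u n.+1 - 1) <= C * (n%:R^-1 - n.+1%:R^-1).
  near=> n.
  have n0 : (0 < n)%N by near: n; exact: nbhs_infty_gt.
  have : cabs (u n.+1 - 1) <= C / n.+1%:R ^+ 2.
    by near: n; case: hC => N _ h; exists N => // n /= hn; apply: h; exact: leqW.
  move=> /le_trans; apply; rewrite ler_wpM2l//.
  have n1 : n%:R != 0 :> R by rewrite pnatr_eq0 -lt0n.
  have n2 : n.+1%:R != 0 :> R by rewrite pnatr_eq0.
  have -> : n%:R^-1 - n.+1%:R^-1 = (n%:R * n.+1%:R)^-1 :> R.
    by rewrite -natr1 in n2 *; field; rewrite n1 n2.
  rewrite lef_pV2 ?posrE ?exprn_gt0 ?mulr_gt0 ?ltr0n// expr2 ler_pM2r ?ltr0n//.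
  by rewrite ler_nat.
pose s n := \sum_(1 <= k < n.+1) cabs (u k - 1).
have cs : cvgn s.
  apply: (@cvg_of_increments _ C); near=> n.
  rewrite /s big_nat_recr//= addrAC subrr add0r ger0_norm ?cabs_ge0//.
  by near: n.
have [B hB] : exists B, forall n, s n <= B.
  have /cvg_seq_bounded[B [Br hB]] := cs.
  exists (B + 1) => n; apply: le_trans (ler_norm _) _.
  by apply: (hB (B + 1)) => //; rewrite ltrDl.
pose P n : R[i] := \prod_(1 <= k < n.+1) u k.
have PB n : cabs (P n) <= expR B.
  by apply: (le_trans (cabs_prod_le _ _ _)); rewrite ler_expR hB.
have incP : \forall n \near \oo,
    cabs (P n.+1 - P n) <= (expR B * C) * (n%:R^-1 - n.+1%:R^-1).
  near=> n.
  have -> : P n.+1 - P n = P n * (u n.+1 - 1).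
    by rewrite /P big_nat_recr//= mulrBr mulr1.
  rewrite cabsM -mulrA; apply: ler_pM; rewrite ?cabs_ge0//.
  by near: n.
have /cvg_ex[a ha] : cvgn (fun n => complex.Re (P n)).
  apply: (cvg_of_increments (K := expR B * C)); near=> n.
  by rewrite -raddfB (le_trans (Re_le_cabs _))//; near: n.
have /cvg_ex[b hb] : cvgn (fun n => complex.Im (P n)).
  apply: (cvg_of_increments (K := expR B * C)); near=> n.
  by rewrite -raddfB (le_trans (Im_le_cabs _))//; near: n.
by exists (a +i* b); exact: cvg_ReIm.
Unshelve. all: by end_near. Qed.

(** The product of the inverses converges too, and the two limits multiply to
one. *)
Lemma near_one2_cvg_neq0 u (l : R[i]^o) : near_one 2 u ->
  (forall k, (0 < k)%N -> u k != 0) ->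
  (fun n => \prod_(1 <= k < n.+1) u k : R[i]^o) @ \oo --> l -> l != 0.
Proof.
move=> u1 u0 hl; have [l' hl'] := near_one2_cvg (near_oneV (ltn0Sn 1) u1).
apply/eqP => l0.
have h1 n : (\prod_(1 <= k < n.+1) u k) * (\prod_(1 <= k < n.+1) (u k)^-1) = 1.
  rewrite -big_split /= big_nat_cond big1//.
  by move=> k; rewrite andbT => /andP[k0 _]; rewrite divff// u0.
have h := cvgM hl hl'; rewrite l0 mul0r in h.
have [N _ /(_ N (leqnn N))] := (cvgrPdist_lt _ _).1 (h _) 1 ltr01.
by rewrite /= sub0r normrN; have := h1 N; rewrite /GRing.mul_fun => ->; rewrite normr1 ltxx.
Qed.

End InfiniteProducts.

(** * Fourier coefficients of the symbol *)

Section Fourier.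
Context {R : realType}.
Implicit Types (beta w : R[i]) (m k : int).

Lemma sqr_iC : 'i%C * 'i%C = -1 :> R[i].
Proof. by rewrite -expr2 sqr_i. Qed.

Lemma iC_neq0 : 'i%C != 0 :> R[i].
Proof. by rewrite -cabs_eq0 cabs_i oner_eq0. Qed.

Lemma piC_neq0 : (pi%:C : R[i]) != 0.
Proof. by rewrite -cabs_eq0 cabs_real normr_eq0 gt_eqF// pi_gt0. Qed.

Lemma cexp_ipi : cexp ('i%C * pi%:C : R[i]) = -1.
Proof.
by rewrite -[LHS]/(expi pi) expiE cospi sinpi; apply/eqP; rewrite eq_complex /= oppr0 !eqxx.
Qed.

Lemma cexp_2ipi m : cexp ('i%C * pi%:C * (m * 2)%:~R : R[i]) = 1.
Proof.
have nat1 (n : nat) : cexp ('i%C * pi%:C * (n%:Z * 2)%:~R : R[i]) = 1.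
  rewrite intrM mulrC -mulrA -[n%:Z%:~R]/(n%:R) mulr_natl cexpMn.
  by rewrite -[2%:~R]/(2%:R) mulr_natl cexpMn cexp_ipi sqrrN !expr1n.
case: m => n; first exact: nat1.
by rewrite NegzE mulNr mulrNz mulrN cexpN nat1 invr1.
Qed.

(** The case [w = 0] is possible: it occurs in an odd Fourier coefficient when
[beta] is a half-integer.  There the shift relation is all that matters, as it
makes the contributions of the two half-circles cancel. *)
Lemma antiderivative_cexp w : exists F : R -> R[i],
  (forall t, is_cderive t F (cexp (w * t%:C))) /\
  (w != 0 -> forall t, F t = cexp (w * t%:C) / w) /\
  F (2 * pi) - F pi = cexp (w * pi%:C) * (F pi - F 0).
Proof.
have dt t : is_cderive t (fun s => s%:C) (1 : R[i]).
  by apply: is_cderive_real; exact: is_derive_id.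
have [->|w0] := eqVneq w 0.
  exists (fun t => t%:C); split.
    by move=> t; rewrite mul0r cexp0.
  split => //; rewrite mul0r cexp0 rmorphM /= rmorph_nat; ring.
exists (fun t => w^-1 * cexp (w * t%:C)); split.
  move=> t; apply: is_cderive_eq.
    by apply: is_cderiveMl; apply: is_cderive_cexp; apply: is_cderiveMl; exact: dt.
  by rewrite mulr1 mulrA mulVf// mul1r.
split; first by move=> _ t; rewrite mulrC.
rewrite mulr0 cexp0 rmorphM /= rmorph_nat.
have -> : w * (2 * pi%:C) = w * pi%:C + w * pi%:C by ring.
by rewrite cexpD; ring.
Qed.

Definition sinpi_over_pi beta : R[i] :=
  (cexp ('i%C * pi%:C * beta) - cexp (- ('i%C * pi%:C * beta))) / (2 * 'i%C * pi%:C).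

Lemma phi2_left beta (t : R) : 0 < t < pi ->
  phi2 beta (expi t) = cexp (- ('i%C * pi%:C * beta) + 2 * 'i%C * beta * t%:C).
Proof.
move=> /andP[t0 t1]; have p0 := @pi_gt0 R; rewrite phi2E.
have -> : expi (t - pi) = expi (t + pi) :> R[i].
  have -> : t + pi = t - pi + (pi + pi) by ring.
  rewrite [RHS]expiD [X in _ = _ * X]expiD.
  by rewrite -[expi pi]/(cexp ('i%C * pi%:C)) cexp_ipi mulrNN !mulr1.
rewrite !t_E; [|lra|lra].
rewrite -cexpD !rmorphB rmorphD /=; congr cexp; ring.
Qed.

Lemma phi2_right beta (t : R) : pi < t < 2 * pi ->
  phi2 beta (expi t) = cexp (- ('i%C * pi%:C * beta) * 3 + 2 * 'i%C * beta * t%:C).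
Proof.
move=> /andP[t0 t1]; have p0 := @pi_gt0 R; rewrite phi2E.
rewrite !t_E; [|lra|lra].
rewrite -cexpD !rmorphB /=; congr cexp; ring.
Qed.

(** The symbol is [t_ beta] evaluated at the square of its argument: the two
half-circles contribute the same integral up to [(-1) ^ k].  The
antiderivative is only given explicitly when the integrand is not constant. *)
Lemma fourier_phi2 beta k : exists F : R -> R[i],
  fourier (phi2 beta) k = (2 * pi%:C)^-1 * cexp (- ('i%C * pi%:C * beta)) *
    (1 + cexp (- ('i%C * pi%:C * k%:~R))) * (F pi - F 0) /\
  (2 * beta != k%:~R -> forall t, F t =
     cexp ('i%C * (2 * beta - k%:~R) * t%:C) / ('i%C * (2 * beta - k%:~R))).
Proof.
set w := 'i%C * (2 * beta - k%:~R).
have [F [dF [Fw Fpi]]] := antiderivative_cexp w.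
exists F; split; last first.
  by rewrite -subr_eq0 => h; apply: Fw; rewrite mulf_neq0// iC_neq0.
have p0 := @pi_gt0 R.
pose A := cexp (- ('i%C * pi%:C * beta)).
have dE t : is_cderive t (fun s => cexp (w * s%:C)) (w * cexp (w * t%:C)).
  apply: is_cderive_cexp; apply: is_cderive_eq.
    by apply: is_cderiveMl; apply: is_cderive_real; exact: is_derive_id.
  by rewrite mulr1.
rewrite /fourier (@cintegral_derive_pieces _ _
  (fun t => A * cexp (w * t%:C)) (fun t => A ^+ 3 * cexp (w * t%:C))
  (fun t => A * F t) (fun t => A ^+ 3 * F t)
  (fun t => A * (w * cexp (w * t%:C))) (fun t => A ^+ 3 * (w * cexp (w * t%:C)))
  0 pi (2 * pi)); last first.
- move=> t ht; rewrite phi2_right// -[expi (- _)]/(cexp _) /A -cexpMn -!cexpD.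
  congr cexp; rewrite /w rmorphN rmorphM rmorph_int /=; ring.
- move=> t ht; rewrite phi2_left// -[expi (- _)]/(cexp _) /A -!cexpD.
  congr cexp; rewrite /w rmorphN rmorphM rmorph_int /=; ring.
- by move=> t; apply: is_cderiveMl.
- by move=> t; apply: is_cderiveMl.
- by move=> t; apply: is_cderiveMl.
- by move=> t; apply: is_cderiveMl.
- by lra.
rewrite -!mulrBr Fpi -/A fmorphV rmorphM rmorph_nat.
have eA : A ^+ 3 * cexp (w * pi%:C) = A * cexp (- ('i%C * pi%:C * k%:~R)).
  rewrite /A -cexpMn -!cexpD; congr cexp; rewrite /w; ring.
by rewrite [A ^+ 3 * _]mulrA eA; ring.
Qed.

Lemma fourier_phi2_odd beta m : fourier (phi2 beta) (m * 2 + 1) = 0.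
Proof.
have [F [-> _]] := fourier_phi2 beta (m * 2 + 1).
have -> : - ('i%C * pi%:C * (m * 2 + 1)%:~R) =
    - ('i%C * pi%:C * (m * 2)%:~R) - 'i%C * pi%:C :> R[i].
  by rewrite intrD; ring.
rewrite cexpD [cexp (- ('i%C * _ * (m * 2)%:~R))]cexpN [cexp (- ('i%C * pi%:C))]cexpN.
by rewrite cexp_2ipi cexp_ipi invrN !invr1 mul1r subrr mulr0 mul0r.
Qed.

Lemma fourier_phi2_even beta m : beta != m%:~R ->
  fourier (phi2 beta) (m * 2) = sinpi_over_pi beta / (beta - m%:~R).
Proof.
move=> bm; have [F [-> hF]] := fourier_phi2 beta (m * 2).
have i0 := iC_neq0; have p0 := piC_neq0.
have b0 : beta - m%:~R != 0 by rewrite subr_eq0.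
have e2 : 2 * beta - (m * 2)%:~R = 2 * (beta - m%:~R).
  by rewrite intrM -[2%:~R]/(2%:R); ring.
have n2 : 2 * beta != (m * 2)%:~R.
  by rewrite -subr_eq0 e2 mulf_neq0// pnatr_eq0.
rewrite !(hF n2) mulr0 cexp0 [cexp (- ('i%C * _ * (m * 2)%:~R))]cexpN.
rewrite cexp_2ipi invr1 /sinpi_over_pi.
have -> : 'i%C * (2 * beta - (m * 2)%:~R) * pi%:C =
  'i%C * pi%:C * beta + 'i%C * pi%:C * beta - 'i%C * pi%:C * (m * 2)%:~R by ring.
rewrite 2!cexpD [cexp (- ('i%C * _ * (m * 2)%:~R))]cexpN cexp_2ipi invr1 mulr1 e2.
rewrite !cexpN; have := cexp_neq0 ('i%C * pi%:C * beta).
move: (cexp _) => E E0; move: p0 (beta - _) b0 => {hF}.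
move: (pi%:C : R[i]) => P P0 d d0.
by field; rewrite d0 P0 i0 E0.
Qed.

End Fourier.

(** * Cauchy determinants *)

Section Cauchy.
Context {F : fieldType}.
Implicit Types (f : nat -> nat -> F) (x y a r c : nat -> F).

Lemma det_scale_rows_cols n r c f :
  \det (\matrix_(j < n, k < n) (r j * c k * f j k)) =
  (\prod_(j < n) r j) * (\prod_(k < n) c k) * \det (\matrix_(j < n, k < n) f j k).
Proof.
have -> : \matrix_(j < n, k < n) (r j * c k * f j k) =
    diag_mx (\row_j r j) *m (\matrix_(j < n, k < n) f j k) *m diag_mx (\row_k c k).
  apply/matrixP => j k; rewrite mul_diag_mx mul_mx_diag !mxE; ring.
rewrite !det_mulmx !det_diag mulrAC; congr (_ * _ * _);
  by apply: eq_bigr => i _; rewrite mxE.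
Qed.

(** One step of Gaussian elimination, pivoting on the last entry. *)
Lemma det_schur_last n f : f n n != 0 ->
  \det (\matrix_(j < n.+1, k < n.+1) f j k) =
  f n n * \det (\matrix_(j < n, k < n) (f j k - f j n * f n k / f n n)).
Proof.
move=> fn0; rewrite -[n.+1]addn1.
set A := \matrix_(j < n, k < n) f j k.
set B := \matrix_(j < n, k < 1) f j n.
set C := \matrix_(j < 1, k < n) f n k.
have -> : \matrix_(j < n + 1, k < n + 1) f j k = block_mx A B C (f n n)%:M.
  apply/matrixP => j k; rewrite !mxE.
  case: (splitP j) => i ji; rewrite mxE; case: (splitP k) => l kl; rewrite !mxE ji kl//.
  - by rewrite ord1 addn0.
  - by rewrite ord1 addn0.
  - by rewrite !ord1 addn0 eqxx.
have -> : block_mx A B C (f n n)%:M =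
    block_mx 1%:M ((f n n)^-1 *: B) 0 1%:M *m
    block_mx (A - (f n n)^-1 *: (B *m C)) 0 C (f n n)%:M.
  rewrite mulmx_block !mul1mx !mul0mx !add0r -scalemxAl subrK.
  by rewrite mul_mx_scalar scalerA mulfV// scale1r.
rewrite det_mulmx det_ublock det_lblock !det1 !mul1r mulrC det_scalar1.
congr (_ * \det _); apply/matrixP => j k; rewrite !mxE big_ord1 !mxE; ring.
Qed.

(** Since [(y j + x n) (y n + x k) - (y j + x k) (y n + x n)] factors as
[(y j - y n) (x k - x n)], the Schur complement is a Cauchy matrix whose rows
and columns have been rescaled. *)
Lemma det_cauchy_rec n x y : (forall j k, y j + x k != 0) ->
  \det (\matrix_(j < n.+1, k < n.+1) (y j + x k)^-1) =
  (y n + x n)^-1 *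
  \prod_(j < n) ((y j - y n) * (x j - x n) / ((y j + x n) * (y n + x j))) *
  \det (\matrix_(j < n, k < n) (y j + x k)^-1).
Proof.
move=> xy0; rewrite (det_schur_last (f := fun j k => (y j + x k)^-1)) ?invr_eq0//.
rewrite -mulrA; congr (_ * _).
transitivity (\det (\matrix_(j < n, k < n) ((y j - y n) / (y j + x n) *
  ((x k - x n) / (y n + x k)) * (y j + x k)^-1))).
  congr (\det _); apply/matrixP => j k; rewrite !mxE.
  by field; rewrite !xy0 ?oner_neq0.
have /= -> := det_scale_rows_cols n (fun j => (y j - y n) / (y j + x n))
  (fun k => (x k - x n) / (y n + x k)) (fun j k => (y j + x k)^-1).
rewrite -big_split; congr (_ * _); apply: eq_bigr => j _ /=.
by field; rewrite !xy0 ?oner_neq0.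
Qed.

End Cauchy.

Section Determinant.
Context {R : realType}.
Context (beta : R[i]) (betaNint : forall m : int, beta <> m%:~R).
Local Notation c := (sinpi_over_pi beta).

(** Rows and columns of even index [2p] sit at the node [p], those of odd index
[2p+1] at [-(p+1)]: an entry only depends on the distance between two nodes. *)
Definition node (j : nat) : R[i] :=
  if odd j then - (j./2.+1)%:R else (j./2)%:R.

Definition row_sign (j : nat) : R[i] := (-1) ^+ odd j.

Definition row_node (j : nat) : R[i] := row_sign j * beta - node j.

Lemma node_int j : exists m : int, node j = m%:~R.
Proof.
rewrite /node; case: odd; last by exists (j./2)%:Z.
by exists (- (j./2.+1)%:Z); rewrite mulrNz.
Qed.

Lemma row_node_addN0 j k : row_node j + node k != 0.
Proof.
have [m em] := node_int j; have [l el] := node_int k.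
apply/eqP; rewrite /row_node /row_sign em el; case: (odd j) => /= h.
  apply: (betaNint (m := l - m)); rewrite intrB.
  by apply/eqP; rewrite -subr_eq0 -oppr_eq0; apply/eqP; rewrite -h; ring.
apply: (betaNint (m := m - l)); rewrite intrB.
by apply/eqP; rewrite -subr_eq0; apply/eqP; rewrite -h; ring.
Qed.

Lemma fourier_even_int m : fourier (phi2 beta) (m * 2) = c / (beta - m%:~R).
Proof. by apply: fourier_phi2_even; apply/eqP; exact: betaNint. Qed.

(** Exactly one of the indices [j - k] and [j + k + 1] is even, and half of it
is, up to the sign attached to the row, the difference of the two nodes. *)
Lemma M_phi2_entry (j k : nat) :
  fourier (phi2 beta) (j%:Z - k%:Z) + fourier (phi2 beta) (j%:Z + k%:Z + 1) =
  row_sign j * c / (row_node j + node k).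
Proof.
have ej := odd_double_half j; have ek := odd_double_half k.
have divN (a b : R[i]) : b = - a -> c / a = -1 * c / b.
  by move=> ->; rewrite invrN mulN1r mulrNN.
rewrite /row_node /row_sign /node.
case: (odd j) ej => /= ej; case: (odd k) ek => /= ek.
- have -> : j%:Z - k%:Z = (j./2%:Z - k./2%:Z) * 2 by lia.
  have -> : j%:Z + k%:Z + 1 = (j./2%:Z + k./2%:Z + 1) * 2 + 1 by lia.
  rewrite fourier_phi2_odd addr0 fourier_even_int intrB.
  by apply: divN; rewrite -!natr1 -!pmulrn; ring.
- have -> : j%:Z - k%:Z = (j./2%:Z - k./2%:Z) * 2 + 1 by lia.
  have -> : j%:Z + k%:Z + 1 = (j./2%:Z + k./2%:Z + 1) * 2 by lia.
  rewrite fourier_phi2_odd add0r fourier_even_int.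
  by apply: divN; rewrite !intrD -!natr1 -!pmulrn; ring.
- have -> : j%:Z - k%:Z = (j./2%:Z - k./2%:Z - 1) * 2 + 1 by lia.
  have -> : j%:Z + k%:Z + 1 = (j./2%:Z + k./2%:Z + 1) * 2 by lia.
  rewrite fourier_phi2_odd add0r fourier_even_int expr0 !mul1r; congr (_ / _).
  by rewrite !intrD -!natr1 -!pmulrn; ring.
- have -> : j%:Z - k%:Z = (j./2%:Z - k./2%:Z) * 2 by lia.
  have -> : j%:Z + k%:Z + 1 = (j./2%:Z + k./2%:Z) * 2 + 1 by lia.
  rewrite fourier_phi2_odd addr0 fourier_even_int expr0 !mul1r; congr (_ / _).
  by rewrite intrB -!pmulrn; ring.
Qed.

Local Notation D n := (\det (M n (phi2 beta))).

Lemma det_M_phi2 n : D n = (\prod_(j < n) (row_sign j * c)) *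
  \det (\matrix_(j < n, k < n) (row_node j + node k)^-1).
Proof.
have := det_scale_rows_cols n (fun j => row_sign j * c) (fun=> 1)
  (fun j k => (row_node j + node k)^-1).
rewrite (big1 _ _ (fun=> 1))// mulr1 => <-; congr (\det _).
by apply/matrixP => j k; rewrite !mxE M_phi2_entry mulr1.
Qed.

Definition sine_factor (m : nat) : R[i] := 1 - beta ^+ 2 / m%:R ^+ 2.

Definition cross_factor (m : nat) : R[i] :=
  (1 - 2 * beta / m%:R) / (1 - beta / m%:R) ^+ 2.

Lemma natC_neq0 m : (0 < m)%N -> m%:R != 0 :> R[i].
Proof. by rewrite pnatr_eq0 -lt0n. Qed.

Lemma beta_nat_neq0 m : (m%:R - beta != 0) * (m%:R + beta != 0).
Proof.
split.
  by rewrite subr_eq0; apply/eqP => e; apply: (betaNint (m := m%:Z)); rewrite -e.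
rewrite addrC addr_eq0; apply/eqP => e; apply: (betaNint (m := - m%:Z)).
by rewrite mulrNz e.
Qed.

Lemma sine_factorE m : (0 < m)%N ->
  sine_factor m = (m%:R - beta) * (m%:R + beta) / m%:R ^+ 2.
Proof. by move=> /natC_neq0 m0; rewrite /sine_factor; field. Qed.

Lemma cross_factorE m : (0 < m)%N ->
  cross_factor m = m%:R * (m%:R - 2 * beta) / (m%:R - beta) ^+ 2.
Proof.
by move=> /natC_neq0 m0; rewrite /cross_factor; field; rewrite m0 beta_nat_neq0.
Qed.

Lemma sine_factor_neq0 m : (0 < m)%N -> sine_factor m != 0.
Proof.
move=> m0; rewrite sine_factorE// !mulf_neq0 ?beta_nat_neq0//.
by rewrite invr_neq0// expf_neq0// natC_neq0.
Qed.

Lemma prod_parity (G : nat -> R[i]) n :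
  \prod_(j < n) G j =
  (\prod_(p < uphalf n) G p.*2) * (\prod_(p < n./2) G p.*2.+1).
Proof.
elim: n => [|n IH]; first by rewrite !big_ord0 mulr1.
rewrite big_ord_recr IH /=.
have := odd_double_half n; rewrite uphalf_half; case: (odd n) => /= e.
  rewrite add1n in e *; rewrite [X in _ = _ * X]big_ord_recr /= mulrA.
  by congr (_ * G _); lia.
rewrite !add0n in e *; rewrite [X in _ = X * _]big_ord_recr /= mulrAC.
by congr (_ * G _ * _); lia.
Qed.

Definition border_factor (n j : nat) : R[i] :=
  (row_node j - row_node n) * (node j - node n) /
    ((row_node j + node n) * (row_node n + node j)).

(** Here [border_factor] is a ratio of the form [m^2 / ((m - beta) (m + beta))]
with [m] half the distance of the two indices. *)
Lemma border_factor_same n j : odd j = odd n -> (j < n)%N ->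
  border_factor n j = (sine_factor (n./2 - j./2))^-1.
Proof.
move=> ejn jn; have hjn : (j./2 < n./2)%N.
  by have := odd_double_half j; have := odd_double_half n; rewrite ejn; lia.
have m0 : (n./2 - j./2)%:R != 0 :> R[i] by rewrite natC_neq0// subn_gt0.
have [h1 h2] := beta_nat_neq0 (n./2 - j./2).
rewrite sine_factorE ?subn_gt0// invf_div /border_factor.
apply/eqP; rewrite eqr_div ?mulf_neq0 ?row_node_addN0//; apply/eqP.
rewrite /row_node /row_sign /node ejn natrB 1?ltnW//.
by case: (odd n); rewrite /= -?natr1; ring.
Qed.

(** The coefficients of [beta] in the two row nodes are opposite, which is where
[2 beta] enters. *)
Lemma border_factor_other n j : odd j != odd n ->
  border_factor n j = cross_factor (n./2 + j./2).+1.
Proof.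
move=> ejn.
have [h1 h2] := beta_nat_neq0 (n./2 + j./2).+1.
rewrite cross_factorE// /border_factor.
apply/eqP; rewrite eqr_div ?mulf_neq0 ?expf_neq0 ?row_node_addN0//; apply/eqP.
rewrite /row_node /row_sign /node -[(_ + _).+1%:R]natr1 natrD.
by case: (odd n) ejn; case: (odd j) => //= _; rewrite -?natr1; ring.
Qed.

(** Bordering by one row and column: an index of the same parity as [n] at
distance [2m] contributes the inverse of [sine_factor m], an index of the other
parity contributes a [cross_factor]. *)
Lemma det_M_phi2_rec n : D n.+1 =
  c / beta / (\prod_(1 <= m < n./2.+1) sine_factor m) *
  (\prod_(n./2.+1 <= m < n.+1) cross_factor m) * D n.
Proof.
rewrite !det_M_phi2 (det_cauchy_rec n row_node_addN0) big_ord_recr /=.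
set Pr := \prod_(j < n) (row_sign j * c); set Dn := \det _.
have -> : \prod_(j < n) ((row_node j - row_node n) * (node j - node n) /
       ((row_node j + node n) * (row_node n + node j))) =
    (\prod_(1 <= m < n./2.+1) sine_factor m)^-1 *
    (\prod_(n./2.+1 <= m < n.+1) cross_factor m).
  have eo := odd_double_half n; have eu := uphalf_half n.
  rewrite (bigID (fun j : 'I_n => odd j == odd n)) /=.
  rewrite (eq_bigr (fun j : 'I_n => (sine_factor (n./2 - j./2))^-1)); last first.
    by move=> j /eqP e; exact: border_factor_same.
  rewrite [X in _ * X](eq_bigr (fun j : 'I_n => cross_factor (n./2 + j./2).+1)); last first.
    by move=> j; exact: border_factor_other.
  have -> : \prod_(1 <= m < n./2.+1) sine_factor m =
      \prod_(p < n./2) sine_factor (n./2 - p).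
    rewrite big_add1 /= big_mkord (reindex_inj rev_ord_inj) /=.
    by apply: eq_bigr => p _; congr sine_factor; have := ltn_ord p; lia.
  have -> : \prod_(n./2.+1 <= m < n.+1) cross_factor m =
      \prod_(p < uphalf n) cross_factor (n./2 + p).+1.
    rewrite -[n./2.+1]add0n big_addn big_mkord.
    have -> : (n.+1 - n./2.+1)%N = uphalf n by lia.
    by apply: eq_bigr => p _; congr cross_factor; lia.
  rewrite big_mkcond [X in _ * X]big_mkcond /= -prodfV.
  rewrite (prod_parity (fun j => if odd j == odd n then (sine_factor (n./2 - j./2))^-1 else 1)).
  rewrite (prod_parity (fun j => if odd j != odd n then cross_factor (n./2 + j./2).+1 else 1)).
  case: (odd n) eu => /= eu.
    rewrite [X in X * _ * _]big1 => [|p _]; last by rewrite odd_double.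
    rewrite [X in _ * (_ * X)]big1 => [|p _]; last by rewrite odd_double.
    rewrite mul1r mulr1; congr (_ * _); apply: eq_bigr => p _.
      by rewrite odd_double uphalf_double.
    by rewrite odd_double doubleK.
  rewrite [X in _ * X * _]big1 => [|p _]; last by rewrite odd_double.
  rewrite [X in _ * (X * _)]big1 => [|p _]; last by rewrite odd_double.
  rewrite eu add0n mul1r mulr1; congr (_ * _); apply: eq_bigr => p _.
    by rewrite odd_double doubleK.
  by rewrite odd_double uphalf_double.
have -> : c / beta = row_sign n * c / (row_node n + node n).
  rewrite /row_node subrK /row_sign; case: (odd n); rewrite ?expr0 ?expr1 ?mul1r//.
  by rewrite !mulN1r invrN mulrNN.
by ring.
Qed.

End Determinant.

(** * Closed form of the determinant *)

Section ClosedForm.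
Context {R : realType}.
Context (beta : R[i]) (betaNint : forall m : int, beta <> m%:~R).
Local Notation c := (sinpi_over_pi beta).
Local Notation D n := (\det (M n (phi2 beta))).
Local Notation sine_factor := (sine_factor beta).
Local Notation cross_factor := (cross_factor beta).

(** The tail [\prod_(m > N) sine_factor m] of the product for the sine. *)
Definition sine_tail N := c / beta / \prod_(1 <= m < N.+1) sine_factor m.

Lemma det_M_phi2_S n :
  D n.+1 = sine_tail n./2 * \prod_(n./2.+1 <= m < n.+1) cross_factor m * D n.
Proof. exact: det_M_phi2_rec. Qed.

Lemma sine_tailS N : sine_tail N = sine_tail N.+1 * sine_factor N.+1.
Proof.
rewrite /sine_tail [in RHS]big_nat_recr//= invfM mulrA divfK//.
by rewrite sine_factor_neq0.
Qed.

Definition barnes_factor m : R[i] :=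
  (1 - 2 * beta / m%:R) * (1 + beta / m%:R) ^+ 2.

Lemma sine_cross_barnes m : (0 < m)%N ->
  sine_factor m ^+ 2 * cross_factor m = barnes_factor m.
Proof.
move=> m0; have m0' := natC_neq0 (R := R) m0.
have [h1 h2] := beta_nat_neq0 betaNint m.
rewrite sine_factorE// cross_factorE// /barnes_factor.
by field; rewrite m0' h1.
Qed.

(** Bordering from [2N] to [2N+2] raises the exponent of every factor by the
right amount, and the powers of the sine factors freed by passing from one tail
to the next merge with those of the cross factors. *)
Lemma det_M_phi2_double N : D N.*2 = sine_tail N ^+ N.*2 *
  \prod_(1 <= m < N.+1) barnes_factor m ^+ m *
  \prod_(N.+1 <= m < N.*2.+1) cross_factor m ^+ (N.*2 - m).
Proof.
elim: N => [|N IH].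
  by rewrite det_mx00 !big_geq// expr0 !mulr1.
rewrite doubleS !det_M_phi2_S IH -[N.*2.+1./2]/(uphalf N.*2) uphalf_double doubleK.
have eQ : (\prod_(N.+1 <= m < N.*2.+2) cross_factor m) *
    ((\prod_(N.+1 <= m < N.*2.+1) cross_factor m) *
     \prod_(N.+1 <= m < N.*2.+1) cross_factor m ^+ (N.*2 - m)) =
    cross_factor N.+1 ^+ N.+1 *
    \prod_(N.+2 <= m < N.*2.+3) cross_factor m ^+ (N.*2.+2 - m).
  (* A last factor with exponent 0 is added or dropped to align the ranges. *)
  have -> : (\prod_(N.+1 <= m < N.*2.+1) cross_factor m) *
     \prod_(N.+1 <= m < N.*2.+1) cross_factor m ^+ (N.*2 - m) =
     \prod_(N.+1 <= m < N.*2.+2) cross_factor m ^+ (N.*2.+1 - m).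
    rewrite [in RHS]big_nat_recr /=; last lia.
    rewrite subnn expr0 mulr1 -big_split /=.
    rewrite big_nat_cond [RHS]big_nat_cond; apply: eq_bigr => m /andP[/andP[_ hm] _].
    by rewrite -exprS -subSn.
  rewrite -big_split /= [in RHS]big_nat_recr /=; last lia.
  rewrite subnn expr0 mulr1.
  transitivity (\prod_(N.+1 <= m < N.*2.+2) cross_factor m ^+ (N.*2.+2 - m)).
    rewrite big_nat_cond [RHS]big_nat_cond; apply: eq_bigr => m /andP[/andP[_ hm] _].
    by rewrite -exprS -subSn.
  rewrite big_ltn; last lia.
  by congr (_ ^+ _ * _); lia.
set P1 := \prod_(_ <= m < _) cross_factor m in eQ *.
set P2 := \prod_(_ <= m < _) cross_factor m in eQ *.
set Q1 := \prod_(_ <= m < _) _ in eQ *; set Q2 := \prod_(_ <= m < _) _ in eQ *.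
rewrite [in RHS]big_nat_recr //= -[barnes_factor N.+1]sine_cross_barnes//.
set B := \prod_(_ <= m < _) _.
transitivity (sine_tail N ^+ N.*2.+2 * B * (P1 * (P2 * Q1))).
  by rewrite !exprS; ring.
rewrite eQ sine_tailS !exprMn.
have -> : N.*2.+2 = (N.+1 + N.+1)%N by lia.
by rewrite !exprD; ring.
Qed.

(** As all factors but the numerators of the cross factors are nonzero, the
determinant vanishes once such a numerator has entered it. *)
Lemma det_M_phi2_eq0 n : c != 0 ->
  D n = 0 <-> exists m, (0 < m < n)%N /\ 2 * beta = m%:R.
Proof.
move=> c0; have b0 : beta != 0 by apply/eqP; exact: (betaNint (m := 0)).
have t0 N : sine_tail N != 0.
  rewrite /sine_tail; apply: mulf_neq0.
    by apply: mulf_neq0 c0 _; rewrite invr_eq0.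
  rewrite invr_eq0 prodf_seq_neq0.
  apply/allP => m; rewrite mem_index_iota => /andP[m1 _].
  by rewrite sine_factor_neq0.
have cf0 m : (0 < m)%N -> (cross_factor m == 0) = (2 * beta == m%:R).
  move=> m0; rewrite cross_factorE//.
  have [h1 h2] := beta_nat_neq0 betaNint m.
  rewrite !mulf_eq0 invr_eq0 expf_eq0 /= (negPf h1) orbF (negPf (natC_neq0 m0)) /=.
  by rewrite subr_eq0 eq_sym.
elim: n => [|n IH].
  rewrite det_mx00; split; first by move/eqP; rewrite oner_eq0.
  by case=> m [/andP[]].
rewrite det_M_phi2_S; split.
  move/eqP; rewrite mulf_eq0 => /orP[|/eqP/IH[m [/andP[m0 mn] e]]]; last first.
    by exists m; rewrite m0 leqW.
  rewrite mulf_eq0 (negPf (t0 _)) /= prodf_seq_eq0 => /hasP[m].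
  rewrite mem_index_iota => /andP[m1 m2] /=.
  by rewrite cf0 ?(leq_trans _ m1)// => /eqP e; exists m; rewrite (leq_trans _ m1).
move=> [m [/andP[m0]]]; rewrite ltnS leq_eqVlt => /orP[/eqP e|mn] e2.
  apply/eqP; rewrite mulf_eq0 mulf_eq0 prodf_seq_eq0; apply/orP; left; apply/orP; right.
  apply/hasP; exists m; last by rewrite /= cf0// e2.
  by rewrite mem_index_iota e; lia.
have -> : D n = 0 by apply/IH; exists m; rewrite m0 mn.
by rewrite mulr0.
Qed.

End ClosedForm.

(** * Wallis integrals with a complex frequency *)

Section ComplexIntegral.
Context {R : realType}.
Implicit Types (f g F : R -> R[i]) (a b t : R) (w : R[i]).
Local Notation mu := (@lebesgue_measure R).

Definition cdifferentiable f := exists df, forall t, is_cderive t f (df t).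

Lemma cdifferentiableD f g : cdifferentiable f -> cdifferentiable g ->
  cdifferentiable (fun t => f t + g t).
Proof. by move=> [df hf] [dg hg]; eexists => t; exact: is_cderiveD. Qed.

Lemma cdifferentiableM f g : cdifferentiable f -> cdifferentiable g ->
  cdifferentiable (fun t => f t * g t).
Proof. by move=> [df hf] [dg hg]; eexists => t; exact: is_cderiveM. Qed.

Lemma cdifferentiableMl w f : cdifferentiable f ->
  cdifferentiable (fun t => w * f t).
Proof. by move=> [df hf]; eexists => t; exact: is_cderiveMl. Qed.

Lemma cdifferentiable_continuous f : cdifferentiable f ->
  continuous (fun t => complex.Re (f t)) /\ continuous (fun t => complex.Im (f t)).
Proof.
by move=> [df h]; split; [exact: is_derive1_continuous (fun t => (h t).1)
  | exact: is_derive1_continuous (fun t => (h t).2)].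
Qed.

Lemma cintegral_derive F f a b : a < b -> cdifferentiable f ->
  (forall t, is_cderive t F (f t)) -> cintegral a b f = F b - F a.
Proof.
move=> ab /cdifferentiable_continuous[cR cI] dF.
apply/eqP; rewrite eq_complex /= !raddfB /=; apply/andP; split; apply/eqP.
  by rewrite /Rintegral (integral_derive ab cR (fun t => (dF t).1)).
by rewrite /Rintegral (integral_derive ab cI (fun t => (dF t).2)).
Qed.

Lemma cintegralD f g a b : cdifferentiable f -> cdifferentiable g ->
  cintegral a b (fun t => f t + g t) = cintegral a b f + cintegral a b g.
Proof.
move=> /cdifferentiable_continuous[fR fI] /cdifferentiable_continuous[gR gI].
rewrite /cintegral; apply/eqP; rewrite eq_complex /=; apply/andP; split; apply/eqP.
  rewrite -RintegralD//; try exact: continuous_segment_integrable.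
  by apply: eq_Rintegral => t _; rewrite raddfD.
rewrite -RintegralD//; try exact: continuous_segment_integrable.
by apply: eq_Rintegral => t _; rewrite raddfD.
Qed.

Lemma cintegralMl w f a b : cdifferentiable f ->
  cintegral a b (fun t => w * f t) = w * cintegral a b f.
Proof.
move=> /cdifferentiable_continuous[fR fI].
have hZ (r : R) (u : R -> R) : continuous u ->
    mu.-integrable `[a, b] (EFin \o (fun t => r * u t)).
  move=> cu; apply: continuous_segment_integrable => t.
  by apply: cvgMr; exact: cu.
have iR := continuous_segment_integrable a b fR.
have iI := continuous_segment_integrable a b fI.
have eR : (fun t => complex.Re (w * f t)) = (fun t =>
    complex.Re w * complex.Re (f t) - complex.Im w * complex.Im (f t)).
  by apply/funext => t; rewrite Re_mulC.
have eI : (fun t => complex.Im (w * f t)) = (fun t =>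
    complex.Re w * complex.Im (f t) + complex.Im w * complex.Re (f t)).
  by apply/funext => t; rewrite Im_mulC.
rewrite /cintegral eR eI; apply/eqP; rewrite eq_complex Re_mulC Im_mulC /=.
apply/andP; split; apply/eqP.
  by rewrite -!RintegralZl// -RintegralB//; exact: hZ.
by rewrite -!RintegralZl// -RintegralD//; exact: hZ.
Qed.

Lemma cabs_cintegral_le f (g : R -> R) a b : cdifferentiable f -> continuous g ->
  (forall t, a <= t <= b -> cabs (f t) <= g t) ->
  cabs (cintegral a b f) <= 2 * \int[mu]_(t in `[a, b]) g t.
Proof.
move=> /cdifferentiable_continuous[fR fI] cg fg.
have ig := continuous_segment_integrable a b cg.
have half (u : R -> R) : continuous u -> (forall t, `|u t| <= cabs (f t)) ->
    `|\int[mu]_(t in `[a, b]) u t| <= \int[mu]_(t in `[a, b]) g t.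
  move=> cu ule; have iu := continuous_segment_integrable a b cu.
  apply: (le_trans (le_normr_Rintegral _ iu)) => //.
  apply: le_Rintegral => //.
    apply: (@continuous_segment_integrable _ (fun t => `|u t|)) => t.
    by apply: cvg_norm; exact: cu.
  move=> t /=; rewrite in_itv /= => tab.
  exact: le_trans (ule t) (fg t tab).
apply: (le_trans (cabs_le_ReIm _)); rewrite mulr_natl mulr2n /=.
by apply: lerD; apply: half => // t; [exact: Re_le_cabs | exact: Im_le_cabs].
Qed.

End ComplexIntegral.

Section Wallis.
Context {R : realType}.
Implicit Types (w z : R[i]) (t : R) (n : nat).
Local Notation mu := (@lebesgue_measure R).

Definition ccos z := (cexp ('i%C * z) + cexp (- ('i%C * z))) / 2.
Definition csin z := (cexp ('i%C * z) - cexp (- ('i%C * z))) / (2 * 'i%C).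

Lemma ccos0 : ccos 0 = 1.
Proof. by rewrite /ccos mulr0 oppr0 cexp0 -[1 + 1]/(2%:R) divff// pnatr_eq0. Qed.

Lemma csin0 : csin 0 = 0.
Proof. by rewrite /csin mulr0 oppr0 subrr mul0r. Qed.

Lemma is_cderive_expi w t :
  is_cderive t (fun s => cexp ('i%C * (w * s%:C))) ('i%C * w * cexp ('i%C * (w * t%:C))).
Proof.
apply: is_cderive_cexp; apply: is_cderiveMl; apply: is_cderive_eq.
  by apply: is_cderiveMl; apply: is_cderive_real; exact: is_derive_id.
by rewrite mulr1.
Qed.

Lemma is_cderive_expiN w t : is_cderive t (fun s => cexp (- ('i%C * (w * s%:C))))
  (- ('i%C * w) * cexp (- ('i%C * (w * t%:C)))).
Proof.
apply: (@is_cderive_ext _ _ (fun s => cexp ('i%C * (- w * s%:C)))).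
  by move=> s; congr cexp; ring.
apply: is_cderive_eq (is_cderive_expi (- w) t) _.
by rewrite mulrN; congr (_ * cexp _); ring.
Qed.

Lemma is_cderive_ccos w t :
  is_cderive t (fun s => ccos (w * s%:C)) (- w * csin (w * t%:C)).
Proof.
apply: (@is_cderive_ext _ _ (fun s => 2^-1 *
    (cexp ('i%C * (w * s%:C)) + cexp (- ('i%C * (w * s%:C)))))).
  by move=> s; rewrite mulrC.
apply: is_cderive_eq.
  by apply: is_cderiveMl; apply: is_cderiveD; [exact: is_cderive_expi|exact: is_cderive_expiN].
rewrite /csin; set A := cexp _; set B := cexp _.
have -> : (2 * 'i%C)^-1 = - 'i%C / 2 :> R[i].
  rewrite invfM mulrC; congr (_ / _); apply: (mulfI (iC_neq0 (R := R))).
  by rewrite mulfV ?iC_neq0// mulrN sqr_iC opprK.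
by ring.
Qed.

Lemma is_cderive_csin w t :
  is_cderive t (fun s => csin (w * s%:C)) (w * ccos (w * t%:C)).
Proof.
apply: (@is_cderive_ext _ _ (fun s => (2 * 'i%C)^-1 *
    (cexp ('i%C * (w * s%:C)) + -1 * cexp (- ('i%C * (w * s%:C)))))).
  by move=> s; rewrite mulN1r mulrC.
apply: is_cderive_eq.
  apply: is_cderiveMl; apply: is_cderiveD; first exact: is_cderive_expi.
  by apply: is_cderiveMl; exact: is_cderive_expiN.
have i0 := iC_neq0 (R := R).
by rewrite /ccos; move: (cexp _) (cexp _) => A B; field; exact: i0.
Qed.

Lemma is_cderive_cos t : is_cderive t (fun s => (cos s)%:C) (- (sin t)%:C : R[i]).
Proof.
by rewrite -rmorphN; apply: is_cderive_real; exact: is_derive_cos.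
Qed.

Lemma is_cderive_sin t : is_cderive t (fun s => (sin s)%:C) ((cos t)%:C : R[i]).
Proof. by apply: is_cderive_real; exact: is_derive_sin. Qed.

Definition wallis w n : R[i] :=
  cintegral 0 (pi / 2) (fun t => (cos t)%:C ^+ n * ccos (w * t%:C)).

Lemma cdifferentiable_wallis w n :
  cdifferentiable (fun t => (cos t)%:C ^+ n * ccos (w * t%:C)).
Proof.
apply: cdifferentiableM.
  by eexists => t; apply: is_cderiveX; exact: is_cderive_cos.
by eexists => t; exact: is_cderive_ccos.
Qed.

Lemma cos2Dsin2C t : (sin t)%:C ^+ 2 = 1 - (cos t)%:C ^+ 2 :> R[i].
Proof.
have e : sin t ^+ 2 = 1 - cos t ^+ 2 by rewrite -(cos2Dsin2 t); ring.
by rewrite -rmorphXn e rmorphB rmorph1 rmorphXn.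
Qed.

(** The function [- (cos ^ (n+2))' ccos (w t) + cos ^ (n+2) (ccos (w t))'] vanishes at
both ends, and its derivative is read off from
[(cos ^ n)'' = n (n - 1) cos ^ (n-2) - n ^ 2 cos ^ n]. *)
Lemma wallis_rec w n :
  (n.+2%:R ^+ 2 - w ^+ 2) * wallis w n.+2 = n.+2%:R * n.+1%:R * wallis w n.
Proof.
have dn := cdifferentiable_wallis w n; have dn2 := cdifferentiable_wallis w n.+2.
pose G t := n.+2%:R * ((cos t)%:C ^+ n.+1 * (sin t)%:C * ccos (w * t%:C)) +
   - w * ((cos t)%:C ^+ n.+2 * csin (w * t%:C)).
pose g t := (n.+2%:R ^+ 2 - w ^+ 2) * ((cos t)%:C ^+ n.+2 * ccos (w * t%:C)) +
   - (n.+2%:R * n.+1%:R) * ((cos t)%:C ^+ n * ccos (w * t%:C)).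
have dG t : is_cderive t G (g t).
  apply: is_cderive_eq.
    apply: is_cderiveD.
      apply: is_cderiveMl; apply: is_cderiveM; last exact: is_cderive_ccos.
      apply: is_cderiveM; last exact: is_cderive_sin.
      by apply: is_cderiveX; exact: is_cderive_cos.
    apply: is_cderiveMl; apply: is_cderiveM; last exact: is_cderive_csin.
    by apply: is_cderiveX; exact: is_cderive_cos.
  rewrite /g /=; have := cos2Dsin2C t; move: (cos t)%:C (sin t)%:C => C S s2.
  move: (ccos _) (csin _) => K L.
  apply/eqP; rewrite -subr_eq0; apply/eqP.
  transitivity (n.+2%:R * n.+1%:R * C ^+ n * K * (1 - C ^+ 2 - S ^+ 2)).
    by rewrite !exprS -[n.+2%:R]natr1; ring.
  by rewrite s2 subrr mulr0.
have := @cintegral_derive _ G g 0 (pi / 2).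
rewrite /g cintegralD; [|exact: cdifferentiableMl|exact: cdifferentiableMl].
rewrite !cintegralMl// -!/(wallis _ _) => h.
apply/eqP; rewrite -subr_eq0 -[- (_ * wallis _ _)]mulNr h//.
- by rewrite /G cos_pihalf sin0 !exprS !(mul0r, mulr0) csin0 !(mulr0, addr0) subrr.
- by rewrite divr_gt0 ?pi_gt0.
- by apply: cdifferentiableD; exact: cdifferentiableMl.
Qed.

End Wallis.

(** * The tail of the sine product *)

Section SineTail.
Context {R : realType}.
Implicit Types (w z beta : R[i]) (t : R) (n : nat).
Local Notation mu := (@lebesgue_measure R).

Definition real_wallis n : R := \int[mu]_(t in `[0, pi / 2]) cos t ^+ n.

Lemma wallis_real n : wallis 0 n = (real_wallis n)%:C.
Proof.
rewrite /wallis.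
have -> : (fun t : R => (cos t)%:C ^+ n * ccos (0 * t%:C)) = (fun t => (cos t ^+ n)%:C).
  by apply/funext => t; rewrite mul0r ccos0 mulr1 rmorphXn.
rewrite /cintegral /=; apply/eqP; rewrite eq_complex /= eqxx /=; apply/eqP.
by rewrite Rintegral_cst// mul0r.
Qed.

Lemma real_wallis_rec n : real_wallis n.+2 = n.+1%:R / n.+2%:R * real_wallis n.
Proof.
have := wallis_rec (0 : R[i]) n; rewrite !wallis_real expr0n subr0 expr2 -!mulrA.
move=> /(mulfI (natC_neq0 (R := R) (ltn0Sn n.+1))) h.
have {}h : n.+2%:R * real_wallis n.+2 = n.+1%:R * real_wallis n.
  by apply: (@complexI R); rewrite !rmorphM !rmorph_nat.
have n0 : n.+2%:R != 0 :> R by rewrite pnatr_eq0.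
by apply: (mulfI n0); rewrite h !mulrA; congr (_ * _); rewrite [RHS]mulrAC divff// mul1r.
Qed.

Lemma real_wallis0 : real_wallis 0 = pi / 2.
Proof.
apply: (@complexI R); rewrite -wallis_real /wallis.
rewrite (@cintegral_derive _ (fun t => t%:C)) ?subr0//.
- by rewrite divr_gt0 ?pi_gt0.
- exact: cdifferentiable_wallis.
- by move=> t; rewrite expr0 mul0r ccos0 mul1r; apply: is_cderive_real; exact: is_derive_id.
Qed.

Lemma real_wallis_gt0 N : 0 < real_wallis N.*2.
Proof.
elim: N => [|N IH]; first by rewrite real_wallis0 divr_gt0 ?pi_gt0.
by rewrite doubleS real_wallis_rec mulr_gt0// divr_gt0.
Qed.

Lemma wallis_init w : w != 0 -> wallis w 0 = csin (w * (pi / 2)%:C) / w.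
Proof.
move=> w0; rewrite /wallis.
rewrite (@cintegral_derive _ (fun t => w^-1 * csin (w * t%:C))).
- by rewrite mulr0 csin0 mulr0 subr0 mulrC.
- by rewrite divr_gt0 ?pi_gt0.
- exact: cdifferentiable_wallis.
- move=> t; rewrite expr0 mul1r; apply: is_cderive_eq.
    by apply: is_cderiveMl; exact: is_cderive_csin.
  by rewrite mulKf.
Qed.

(** Both sides satisfy the same recurrence, so the tail of the sine product is
exactly a ratio of two Wallis integrals. *)
Lemma wallis_sine_tail beta N : (forall m : int, beta <> m%:~R) ->
  wallis (2 * beta) N.*2 = sine_tail beta N * (real_wallis N.*2)%:C.
Proof.
move=> bN; have b0 : beta != 0 by apply/eqP; exact: (bN 0).
elim: N => [|N IH].
  rewrite wallis_init ?mulf_neq0 ?pnatr_eq0// real_wallis0 /sine_tail big_geq//.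
  have -> : (pi / 2)%:C = pi%:C / 2 :> R[i] by rewrite rmorphM fmorphV rmorph_nat.
  rewrite invr1 mulr1 /sinpi_over_pi /csin.
  have -> : 'i%C * (2 * beta * (pi%:C / 2)) = 'i%C * pi%:C * beta :> R[i] by field.
  have i0 := iC_neq0 (R := R); have := piC_neq0 (R := R).
  set e := 'i%C * pi%:C * beta; move: (cexp e) (cexp (- e)) => A B {e}.
  move: (pi%:C : R[i]) => P P0.
  by field; rewrite i0 P0 b0.
have n0 : N.*2.+2%:R != 0 :> R[i] by rewrite natC_neq0.
have s0 := sine_factor_neq0 bN (ltn0Sn N).
have e1 : N.*2.+2%:R = 2 * N.+1%:R :> R[i] by rewrite -doubleS -mul2n natrM.
have := wallis_rec (2 * beta) N.*2.
have -> : N.*2.+2%:R ^+ 2 - (2 * beta) ^+ 2 = N.*2.+2%:R ^+ 2 * sine_factor beta N.+1.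
  rewrite /sine_factor e1; have := natC_neq0 (R := R) (ltn0Sn N).
  by move: (N.+1%:R) => d d0; field.
rewrite IH sine_tailS// doubleS => h.
have h2 := wallis_rec (0 : R[i]) N.*2; rewrite !wallis_real expr0n subr0 in h2.
apply: (mulfI (expf_neq0 2 n0)); apply: (mulIf s0).
rewrite mulrAC h.
transitivity (sine_tail beta N.+1 * sine_factor beta N.+1 *
   (N.*2.+2%:R * N.*2.+1%:R * (real_wallis N.*2)%:C)); first by ring.
by rewrite -h2; ring.
Qed.

(** From [sin t = 2 sin (t/2) cos (t/2)] and [sin (t/2) >= (t/2) cos (t/2)] one
gets [sin t >= t cos (t/2) ^ 2 = t (1 + cos t) / 2]. *)
Lemma jordan_half t : 0 <= t <= pi / 2 -> t <= 2 * sin t.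
Proof.
move=> /andP[t0 t1]; have p0 := @pi_gt0 R.
have [x] := @MVT_segment _ sin cos 0 (t / 2) ltac:(lra) (fun x _ => is_derive_sin x)
  (continuous_within_segment (a := 0) (b := t / 2) (is_derive1_continuous (@is_derive_sin R))).
rewrite in_itv/= => /andP[x0 x1]; rewrite sin0 !subr0 => e.
have hc : cos (t / 2) <= cos x.
  rewrite leNgt ltr_cos ?in_itv/= -?leNgt//; apply/andP; split; lra.
have c0 : 0 <= cos t by apply: cos_ge0_pihalf; apply/andP; split; lra.
have e2 : t = (t / 2) *+ 2 by rewrite -mulr_natr; lra.
have es : sin t = 2 * (cos (t / 2) * sin (t / 2)) by rewrite {1}e2 sin_mulr2n mulr_natl.
have ec : cos t = 2 * cos (t / 2) ^+ 2 - 1 by rewrite {1}e2 cos_mulr2n mulr_natl.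
rewrite es e; rewrite ec in c0.
have ch : 0 <= cos (t / 2) by apply: cos_ge0_pihalf; apply/andP; split; lra.
have := ler_wpM2l ch hc; rewrite -expr2 => h.
have : 1 / 2 <= cos (t / 2) * cos x by lra.
by move=> /(ler_wpM2r t0); nra.
Qed.

(** The crude supremum bound on [0, t] loses only a constant factor, and it
integrates a Taylor remainder one order at a time. *)
Lemma increment_pow (f df : R -> R[i]) (K b : R) k :
  (forall t, is_cderive t f (df t)) -> f 0 = 0 -> 0 <= K ->
  (forall t, 0 <= t <= b -> cabs (df t) <= K * t ^+ k) ->
  forall t, 0 <= t <= b -> cabs (f t) <= 2 * K * t ^+ k.+1.
Proof.
move=> dfE f0 K0 hK t /andP[t0 tb].
have := @cabs_increment_le _ f df (K * t ^+ k) 0 t t0 dfE.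
rewrite f0 !subr0 exprSr !mulrA; apply => s /andP[s0 st].
apply: le_trans (hK s _) _; first by rewrite s0 (le_trans st).
by rewrite ler_wpM2l// lerXn2r// nnegrE (le_trans s0).
Qed.

Lemma cabs_ccos_le z : cabs (ccos z) <= expR (cabs z).
Proof.
rewrite /ccos cabsM cabsV cabs_nat.
have h := cabsD (cexp ('i%C * z)) (cexp (- ('i%C * z))).
have h1 := cabs_cexp_le ('i%C * z); have h2 := cabs_cexp_le (- ('i%C * z)).
rewrite cabsN cabsM cabs_i mul1r in h2; rewrite cabsM cabs_i mul1r in h1.
lra.
Qed.

(** Fourth-order Taylor bound, with the even powers of [t] traded for powers of
[sin t] so as to be integrated against powers of the cosine. *)
Lemma ccos_sub_sin2_le w : exists C : R, 0 <= C /\ forall t, 0 <= t <= pi / 2 ->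
  cabs (ccos (w * t%:C) - 1 + w ^+ 2 / 2 * (sin t)%:C ^+ 2) <= C * sin t ^+ 4.
Proof.
pose S t : R[i] := (sin t)%:C; pose K t : R[i] := (cos t)%:C.
(* [h1] to [h4] are the successive derivatives of [h]; all of them but [h4]
   vanish at 0, and [h4] is bounded on the interval. *)
pose h t := ccos (w * t%:C) + (-1 + w ^+ 2 / 2 * S t ^+ 2).
pose h1 t := - w * csin (w * t%:C) + w ^+ 2 * (S t * K t).
pose h2 t := - w ^+ 2 * ccos (w * t%:C) + w ^+ 2 * (K t ^+ 2 + -1 * S t ^+ 2).
pose h3 t := w ^+ 3 * csin (w * t%:C) + - (4 * w ^+ 2) * (S t * K t).
pose h4 t := w ^+ 4 * ccos (w * t%:C) + - (4 * w ^+ 2) * (K t ^+ 2 + -1 * S t ^+ 2).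
have dS t : is_cderive t S (K t) by exact: is_cderive_sin.
have dK t : is_cderive t K (- S t) by exact: is_cderive_cos.
have dSK t : is_cderive t (fun s => S s * K s) (K t ^+ 2 + -1 * S t ^+ 2).
  by apply: is_cderive_eq (is_cderiveM (dS t) (dK t)) _; ring.
have dKS t : is_cderive t (fun s => K s ^+ 2 + -1 * S s ^+ 2) (- 4 * (S t * K t)).
  apply: is_cderive_eq.
    apply: is_cderiveD (is_cderiveX 2 (dK t)) (is_cderiveMl _ (is_cderiveX 2 (dS t))).
  by rewrite /= !expr1; ring.
have d1 t : is_cderive t h (h1 t).
  apply: is_cderive_eq.
    apply: is_cderiveD (is_cderive_ccos w t) (is_cderiveD (is_cderive_cst _ _)
      (is_cderiveMl _ (is_cderiveX 2 (dS t)))).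
  by rewrite /h1 /= expr1; field.
have d2 t : is_cderive t h1 (h2 t).
  apply: is_cderive_eq.
    exact: is_cderiveD (is_cderiveMl _ (is_cderive_csin w t)) (is_cderiveMl _ (dSK t)).
  by rewrite /h2; ring.
have d3 t : is_cderive t h2 (h3 t).
  apply: is_cderive_eq.
    exact: is_cderiveD (is_cderiveMl _ (is_cderive_ccos w t)) (is_cderiveMl _ (dKS t)).
  by rewrite /h3; ring.
have d4 t : is_cderive t h3 (h4 t).
  apply: is_cderive_eq.
    exact: is_cderiveD (is_cderiveMl _ (is_cderive_csin w t)) (is_cderiveMl _ (dSK t)).
  by rewrite /h4; ring.
have S0 : S 0 = 0 by rewrite /S sin0.
have K0 : K 0 = 1 by rewrite /K cos0.
pose C := cabs w ^+ 4 * expR (cabs w * (pi / 2)) + 8 * cabs w ^+ 2.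
have C0 : 0 <= C.
  by rewrite addr_ge0 ?mulr_ge0 ?exprn_ge0 ?cabs_ge0 ?expR_ge0.
have b4 t : 0 <= t <= pi / 2 -> cabs (h4 t) <= C * t ^+ 0.
  move=> /andP[t0 t1]; rewrite expr0 mulr1 /h4.
  apply: (le_trans (cabsD _ _)); rewrite [cabs (w ^+ 4 * _)]cabsM [cabs (- _ * _)]cabsM cabsX.
  apply: lerD.
    rewrite ler_wpM2l ?exprn_ge0 ?cabs_ge0// (le_trans (cabs_ccos_le _))// ler_expR.
    by rewrite cabsM cabs_real ger0_norm// ler_wpM2l ?cabs_ge0.
  rewrite cabsN cabsM cabsX cabs_nat.
  have : cabs (K t ^+ 2 + -1 * S t ^+ 2) <= 2.
    have -> : K t ^+ 2 + -1 * S t ^+ 2 = (cos t ^+ 2 - sin t ^+ 2)%:C.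
      by rewrite rmorphB !rmorphXn mulN1r.
    rewrite cabs_real ler_norml; have := cos2Dsin2 t.
    by have := sqr_ge0 (cos t); have := sqr_ge0 (sin t); lra.
  have := exprn_ge0 2 (cabs_ge0 w); move: (cabs w ^+ 2) (cabs _) => a b; nra.
have b3 := increment_pow d4 _ C0 b4.
have {}b3 : forall t, 0 <= t <= pi / 2 -> cabs (h3 t) <= 2 * C * t ^+ 1.
  by apply: b3; rewrite /h3 S0 mulr0 csin0 mul0r !mulr0 addr0.
have b2 : forall t, 0 <= t <= pi / 2 -> cabs (h2 t) <= 2 * (2 * C) * t ^+ 2.
  apply: (increment_pow d3) b3; last by rewrite mulr_ge0.
  by rewrite /h2 S0 K0 mulr0 ccos0; ring.
have b1 : forall t, 0 <= t <= pi / 2 -> cabs (h1 t) <= 2 * (2 * (2 * C)) * t ^+ 3.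
  apply: (increment_pow d2) b2; last by rewrite !mulr_ge0.
  by rewrite /h1 S0 mulr0 csin0 mul0r !mulr0 addr0.
have b0 : forall t, 0 <= t <= pi / 2 -> cabs (h t) <= 2 * (2 * (2 * (2 * C))) * t ^+ 4.
  apply: (increment_pow d1) b1; last by rewrite !mulr_ge0.
  by rewrite /h S0 mulr0 ccos0; ring.
(* The factor [2 ^+ 4] pays for replacing [t] by [2 * sin t]. *)
exists (2 * (2 * (2 * (2 * C))) * 2 ^+ 4); split; first by rewrite !mulr_ge0.
move=> t ht; have := b0 t ht; rewrite /h addrA => /le_trans; apply.
rewrite -[leRHS]mulrA -exprMn ler_wpM2l ?mulr_ge0// lerXn2r//.
- by rewrite nnegrE; case/andP: ht.
- by rewrite nnegrE (le_trans _ (jordan_half ht))//; case/andP: ht.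
- exact: jordan_half.
Qed.

End SineTail.

Section SineTailEstimate.
Context {R : realType}.
Implicit Types (w z beta : R[i]) (t : R) (n : nat).
Local Notation mu := (@lebesgue_measure R).

(** [sin ^ 4] is [1 - 2 cos ^ 2 + cos ^ 4], and the three resulting Wallis integrals
are rational multiples of the first. *)
Lemma integral_sin4_cos N (C : R) :
  \int[mu]_(t in `[0, pi / 2]) (C * sin t ^+ 4 * cos t ^+ N.*2) =
  C * (3 / (N.*2.+2%:R * N.*2.+4%:R)) * real_wallis N.*2.
Proof.
have cc n : continuous (fun t : R => cos t ^+ n).
  move=> t; apply: (@continuous_comp _ _ _ cos (fun x => x ^+ n)).
    exact: continuous_cos.
  exact: exprn_continuous.
have ci n := continuous_segment_integrable 0 (pi / 2) (cc n).
have ii (u : R -> R) : continuous u -> mu.-integrable `[0, pi / 2] (EFin \o u).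
  exact: continuous_segment_integrable.
pose a t : R := cos t ^+ N.*2; pose b t : R := cos t ^+ N.*2.+2.
pose d t : R := cos t ^+ N.*2.+4.
have [ca cb0 cd] : [/\ continuous a, continuous b & continuous d] by split; exact: cc.
have cb : continuous (fun t => 2 * b t) by move=> t; apply: cvgMr; exact: cc.
have cab : continuous (fun t => a t - 2 * b t).
  by move=> t; apply: cvgB; [exact: cc | exact: cb].
have cabd : continuous (fun t => a t - 2 * b t + d t).
  by move=> t; apply: cvgD; [exact: cab | exact: cc].
transitivity (\int[mu]_(t in `[0, pi / 2]) (C * (a t - 2 * b t + d t))).
  apply: eq_Rintegral => t _; rewrite /a /b /d.
  have -> : sin t ^+ 4 = (1 - cos t ^+ 2) ^+ 2 by rewrite -sin2cos2 -exprM.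
  by rewrite !exprS; ring.
rewrite RintegralZl//; last exact: ii.
have -> : \int[mu]_(t in `[0, pi / 2]) (a t - 2 * b t + d t) =
    \int[mu]_(t in `[0, pi / 2]) (a t - 2 * b t) + \int[mu]_(t in `[0, pi / 2]) d t.
  by apply: RintegralD => //; exact: ii.
have -> : \int[mu]_(t in `[0, pi / 2]) (a t - 2 * b t) =
    \int[mu]_(t in `[0, pi / 2]) a t - \int[mu]_(t in `[0, pi / 2]) (2 * b t).
  by apply: RintegralB => //; exact: ii.
rewrite RintegralZl//; last exact: ii.
rewrite /a /b /d -!/(real_wallis _) !real_wallis_rec.
have n2 : N.*2.+2%:R = N.*2%:R + 2 :> R by rewrite -addn2 natrD.
have n3 : N.*2.+3%:R = N.*2%:R + 3 :> R by rewrite -addn3 natrD.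
have n4 : N.*2.+4%:R = N.*2%:R + 4 :> R by rewrite -addn4 natrD.
have n1 : N.*2.+1%:R = N.*2%:R + 1 :> R by rewrite -addn1 natrD.
rewrite n1 n2 n3 n4; have := ler0n R N.*2; move: (N.*2%:R) => x x0.
by field; apply/andP; split; rewrite gt_eqF//; lra.
Qed.

(** Integrating [ccos_sub_sin2_le] against the even power of the cosine: the
quadratic term contributes [beta ^ 2 / (N + 1)] by the Wallis recurrence, and the
remainder is of the order of the mean of [sin ^ 4]. *)
Lemma sine_tail_expansion beta : (forall m : int, beta <> m%:~R) ->
  exists C : R, 0 <= C /\ forall N, (0 < N)%N ->
  cabs (sine_tail beta N - (1 - beta ^+ 2 / N.+1%:R)) <= C / N%:R ^+ 2.
Proof.
move=> bN; have [C [C0 hC]] := ccos_sub_sin2_le (2 * beta).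
exists (6 * C); split => [|N N0]; first by rewrite mulr_ge0.
pose w := 2 * beta; pose K t : R[i] := (cos t)%:C.
pose f t := K t ^+ N.*2 * ccos (w * t%:C) +
  ((-1 + w ^+ 2 / 2) * (K t ^+ N.*2 * ccos (0 * t%:C)) +
   (- (w ^+ 2 / 2)) * (K t ^+ N.*2.+2 * ccos (0 * t%:C))).
have dW z n := cdifferentiable_wallis z n.
have fE : cintegral 0 (pi / 2) f = wallis w N.*2 +
    ((-1 + w ^+ 2 / 2) * wallis 0 N.*2 + (- (w ^+ 2 / 2)) * wallis 0 N.*2.+2).
  rewrite /f cintegralD; [|exact: dW|].
    rewrite cintegralD; [|exact: cdifferentiableMl|exact: cdifferentiableMl].
    by rewrite !cintegralMl.
  by apply: cdifferentiableD; exact: cdifferentiableMl.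
have W0 : 0 < (real_wallis N.*2 : R) by exact: real_wallis_gt0.
have {fE} : cintegral 0 (pi / 2) f =
    (sine_tail beta N - (1 - beta ^+ 2 / N.+1%:R)) * (real_wallis N.*2)%:C.
  have eW : (real_wallis N.*2.+2)%:C =
      N.*2.+1%:R / N.*2.+2%:R * (real_wallis N.*2)%:C :> R[i].
    by rewrite real_wallis_rec !rmorphM fmorphV !rmorph_nat.
  rewrite fE !wallis_real /w wallis_sine_tail// eW.
  have n2 : N.*2.+2%:R = 2 * N.+1%:R :> R[i] by rewrite -doubleS -mul2n natrM.
  have n1 : N.*2.+1%:R = 2 * N.+1%:R - 1 :> R[i].
    by rewrite -n2 -[N.*2.+2%:R]natr1 addrK.
  rewrite n1 n2; have := natC_neq0 (R := R) (ltn0Sn N).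
  move: (N.+1%:R) (sine_tail _ _) (real_wallis _)%:C => x s W x0.
  by field.
move=> fE.
have cg : continuous (fun t : R => C * sin t ^+ 4 * cos t ^+ N.*2).
  move=> t; apply: cvgM; last first.
    apply: (@continuous_comp _ _ _ cos (fun x => x ^+ N.*2)).
      exact: continuous_cos.
    exact: exprn_continuous.
  apply: cvgMr; apply: (@continuous_comp _ _ _ sin (fun x => x ^+ 4)).
    exact: continuous_sin.
  exact: exprn_continuous.
have df : cdifferentiable f.
  by apply: cdifferentiableD => //; apply: cdifferentiableD; exact: cdifferentiableMl.
have := cabs_cintegral_le (a := 0) (b := pi / 2) df cg.
rewrite fE cabsM cabs_real gtr0_norm// integral_sin4_cos !mulrA ler_pM2r// => h.
apply: le_trans (h _) _ => {h}.
  move=> t ht; have := hC t ht; rewrite /f mul0r ccos0 !mulr1.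
  have -> : K t ^+ N.*2 * ccos (w * t%:C) +
     ((-1 + w ^+ 2 / 2) * K t ^+ N.*2 + - (w ^+ 2 / 2) * K t ^+ N.*2.+2) =
     K t ^+ N.*2 * (ccos (w * t%:C) - 1 + w ^+ 2 / 2 * (sin t)%:C ^+ 2).
    by rewrite cos2Dsin2C -/(K t) !exprS; ring.
  rewrite cabsM cabsX cabs_real ger0_norm; last first.
    by case/andP: ht => t0 t1; apply: cos_ge0_pihalf; apply/andP; split => //; have := @pi_ge0 R; lra.
  move=> h; rewrite [leRHS]mulrC ler_wpM2l// exprn_ge0//.
  by case/andP: ht => t0 t1; apply: cos_ge0_pihalf; apply/andP; split => //; have := @pi_ge0 R; lra.
have -> : 2 * C * 3 = 6 * C by ring.
rewrite ler_wpM2l ?mulr_ge0// lef_pV2 ?posrE ?exprn_gt0 ?mulr_gt0 ?ltr0n//.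
by rewrite expr2 -!natrM ler_nat; nia.
Qed.

(** The exponential cancels the first-order term of [sine_tail_expansion], by the
cubic estimate on [(1 - x) exp (x + x^2 / 2)]. *)
Lemma near_one_sine_tail beta : (forall m : int, beta <> m%:~R) ->
  near_one 2 (fun N => sine_tail beta N * cexp (beta ^+ 2 / N.+1%:R)).
Proof.
move=> bN; have [C [C0 hC]] := sine_tail_expansion bN.
pose x N : R[i] := beta ^+ 2 / N.+1%:R; pose B := cabs beta ^+ 2.
have B0 : 0 <= B by rewrite exprn_ge0// cabs_ge0.
have xS N : cabs (x N) = B / N.+1%:R by rewrite /x cabsM cabsV cabsX cabs_nat.
have xN N : (0 < N)%N -> cabs (x N) <= B / N%:R.
  by move=> N0; rewrite xS ler_wpM2l// lef_pV2 ?posrE ?ltr0n// ler_nat.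
have xB N : cabs (x N) <= B.
  by rewrite xS ler_pdivrMr// ler_peMr// ler1n.
have nw : near_one 2 (fun N => (1 - x N) * cexp (x N)).
  have h1 : near_one 3 (fun N => (1 - x N) * cexp (- (- x N) + (- x N) ^+ 2 / 2)).
    apply: (@near_one_weierstrass _ (fun N => - x N) B); near=> N.
    by rewrite cabsN xN//; near: N; exact: nbhs_infty_gt.
  have h2 : near_one 2 (fun N => cexp (- (x N ^+ 2 / 2))).
    apply: (near_one_cexp (B := B ^+ 2)); near=> N.
    have N0 : (0 < N)%N by near: N; exact: nbhs_infty_gt.
    rewrite cabsN cabsM cabsV cabs_nat cabsX -expr_div_n.
    apply: (@le_trans _ _ (cabs (x N) ^+ 2)).
      by rewrite ler_piMr ?exprn_ge0 ?cabs_ge0// invf_le1// ler1n.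
    by rewrite lerXn2r ?xN// nnegrE ?cabs_ge0// divr_ge0.
  apply: near_one_ext (near_oneM (near_one_weaken (leqnSn 2) h1) h2); near=> N.
  by rewrite -mulrA -cexpD sqrrN opprK addrK.
apply: (near_one_perturb (C := C * expR B) nw); near=> N.
rewrite -mulrBl cabsM [leRHS]mulrAC; apply: ler_pM; rewrite ?cabs_ge0//.
  by apply: hC; near: N; exact: nbhs_infty_gt.
apply: (le_trans (cabs_cexp_le _)); rewrite ler_expR; exact: xB.
Unshelve. all: by end_near. Qed.

End SineTailEstimate.

(** * Harmonic numbers and logarithms *)

Section RealLimits.
Context {R : realType}.

Lemma cvg_nat_infty (f : nat -> nat) :
  (forall A, \forall n \near \oo, (A <= f n)%N) -> f @ \oo --> \oo.
Proof. by move=> h; apply/cvgnyPge. Qed.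

Lemma cvg_half : (fun n => n./2) @ \oo --> \oo.
Proof.
apply: cvg_nat_infty => A; near=> n.
have : (A.*2 <= n)%N by near: n; exact: nbhs_infty_ge.
by move=> /half_leq; rewrite doubleK.
Unshelve. all: by end_near. Qed.

Lemma cvg_double : (fun n => n.*2) @ \oo --> \oo.
Proof.
apply: cvg_nat_infty => A; near=> n.
have : (A <= n)%N by near: n; exact: nbhs_infty_ge.
by rewrite -addnn => h; rewrite (leq_trans h)// leq_addr.
Unshelve. all: by end_near. Qed.

Lemma ln_ratio_bounds (n : nat) : (0 < n)%N ->
  n.+1%:R^-1 <= ln (n.+1%:R : R) - ln n%:R <= n%:R^-1.
Proof.
move=> n0; have n0' : 0 < n%:R :> R by rewrite ltr0n.
have n1' : 0 < n.+1%:R :> R by rewrite ltr0n.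
rewrite -ln_div ?posrE//; apply/andP; split.
  have -> : ln (n.+1%:R / n%:R) = - ln (1 + - n.+1%:R^-1 :> R).
    rewrite -lnV ?posrE; last first.
      by rewrite subr_gt0 invf_lt1// ltr1n.
    congr ln; rewrite -natr1 in n1' *; field.
    by rewrite gt_eqF//= gt_eqF// addrK.
  rewrite lerNr le_ln1Dx// ltrN2 invf_lt1 ?ltr1n//.
have -> : n.+1%:R / n%:R = 1 + n%:R^-1 :> R.
  by rewrite -natr1 mulrDl divff ?gt_eqF// mul1r.
by rewrite le_ln1Dx// (lt_trans (ltrN10 _))// invr_gt0.
Qed.

Definition gamma_seq (n : nat) : R := \sum_(1 <= k < n.+1) k%:R^-1 - ln n%:R.

Lemma cvg_gamma_seq : gamma_seq @ \oo --> (euler_gamma : R).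
Proof.
suff : cvgn gamma_seq by [].
apply: (@cvg_of_increments _ _ 1); near=> n.
have n0 : (0 < n)%N by near: n; exact: nbhs_infty_gt.
rewrite mul1r /gamma_seq big_nat_recr//=.
have /andP[h1 h2] := ln_ratio_bounds n0.
have e (S a b d : R) : S + d - a - (S - b) = d - (a - b) by ring.
rewrite e ler_norml; move: h1 h2.
move: (ln n.+1%:R - ln n%:R) (n.+1%:R^-1) (n%:R^-1) => L x y h1 h2.
by apply/andP; split; lra.
Unshelve. all: by end_near. Qed.

(** The powers of [exp (beta ^ 2)] that normalise the cross factors of index
between [N] and [2N].  The denominator [m (m + 1)], rather than [m ^ 2], makes the
sum telescope. *)
Definition weight_sum (N : nat) : R :=
  \sum_(N.+1 <= m < N.*2.+1) (N.*2 - m)%:R / (m%:R * m.+1%:R).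

Lemma weight_sumE N : weight_sum N =
  N.*2%:R * (N.+1%:R^-1 - N.*2.+1%:R^-1) -
  (\sum_(1 <= k < N.*2.+2) k%:R^-1 - \sum_(1 <= k < N.+2) k%:R^-1).
Proof.
have le1 : (N.+1 <= N.*2.+1)%N by lia.
have -> : \sum_(1 <= k < N.*2.+2) k%:R^-1 - \sum_(1 <= k < N.+2) k%:R^-1 =
    \sum_(N.+1 <= m < N.*2.+1) m.+1%:R^-1 :> R.
  rewrite (@big_cat_nat _ _ _ N.+2 1 N.*2.+2)//=.
  by rewrite addrAC subrr add0r [LHS]big_add1.
have -> : N.+1%:R^-1 - N.*2.+1%:R^-1 =
    \sum_(N.+1 <= m < N.*2.+1) (m%:R^-1 - m.+1%:R^-1) :> R.
  rewrite (telescope_sumr_eq (fun m => - m%:R^-1)) ?opprK//.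
    by rewrite addrC.
  by move=> m _; rewrite opprK addrC.
rewrite mulr_sumr -sumrB /weight_sum big_nat_cond [RHS]big_nat_cond.
apply: eq_bigr => m; rewrite andbT => /andP[m1 m2].
rewrite natrB; last by lia.
have m0 : m%:R != 0 :> R by rewrite pnatr_eq0; lia.
have m0' : m.+1%:R != 0 :> R by rewrite pnatr_eq0.
by rewrite -natr1 in m0' *; field; rewrite m0 m0'.
Qed.

Lemma cvg_invn : (fun n => n.+1%:R^-1 : R) @ \oo --> (0 : R).
Proof. exact: cvg_harmonic. Qed.

Lemma cvg_inv_double : (fun n => n.*2.+1%:R^-1 : R) @ \oo --> (0 : R).
Proof. exact: (cvg_comp _ _ cvg_double cvg_invn). Qed.

Lemma cvg_ln_double_ratio :
  (fun N => ln (N.*2.+1%:R : R) - ln N.+1%:R) @ \oo --> ln (2 : R).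
Proof.
have -> : (fun N => ln (N.*2.+1%:R : R) - ln N.+1%:R) =
    (fun N => ln (2 - N.+1%:R^-1 : R)).
  apply/funext => N; rewrite -ln_div ?posrE//; congr ln.
  have n0 : N.+1%:R != 0 :> R by rewrite pnatr_eq0.
  have -> : N.*2.+1%:R = 2 * N.+1%:R - 1 :> R.
    by rewrite -natrM mul2n doubleS -[N.*2.+2%:R]natr1 addrK.
  by field.
apply: continuous_cvg; first exact: continuous_ln.
rewrite -[X in _ --> X]subr0; apply: cvgB; first exact: cvg_cst.
exact: cvg_invn.
Qed.

(** The exponent of [exp (- beta ^ 2)] that is left over once all products have
been normalised to converge. *)
Definition exponent_seq (N : nat) : R :=
  N.*2%:R / N.+1%:R + 3 * (\sum_(1 <= k < N.+1) k%:R^-1) + weight_sum N - 3 * ln N%:R.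

Lemma cvg_exponent_seq :
  exponent_seq @ \oo --> (3 + 3 * euler_gamma - ln 2 : R).
Proof.
have -> : exponent_seq = (fun N => (2 - 2 * N.+1%:R^-1) + 3 * gamma_seq N +
    ((2 - 2 * N.+1%:R^-1) - (1 - N.*2.+1%:R^-1)) -
    ((gamma_seq N.*2.+1 - gamma_seq N.+1) + (ln (N.*2.+1%:R : R) - ln N.+1%:R))).
  apply/funext => N; rewrite /exponent_seq weight_sumE /gamma_seq.
  have n0 : N.+1%:R != 0 :> R by rewrite pnatr_eq0.
  have n1 : N.*2.+1%:R != 0 :> R by rewrite pnatr_eq0.
  have e1 : N.*2%:R / N.+1%:R = 2 - 2 * N.+1%:R^-1 :> R.
    by rewrite -mul2n natrM; rewrite -natr1 in n0 *; field.
  have e2 : N.*2%:R / N.*2.+1%:R = 1 - N.*2.+1%:R^-1 :> R.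
    by rewrite -natr1 in n1 *; field.
  by rewrite mulrBr e1 e2; ring.
have h2 : (fun N => 2 - 2 * N.+1%:R^-1 : R) @ \oo --> (2 - 2 * 0 : R).
  by apply: cvgB; [exact: cvg_cst | apply: cvgMr; exact: cvg_invn].
have g1 : (fun N => gamma_seq N.*2.+1) @ \oo --> (euler_gamma : R).
  apply: (cvg_comp _ _ _ cvg_gamma_seq); apply: cvg_nat_infty => A; near=> n.
  have : (A <= n)%N by near: n; exact: nbhs_infty_ge.
  lia.
have g2 : (fun N => gamma_seq N.+1) @ \oo --> (euler_gamma : R).
  apply: (cvg_comp _ _ _ cvg_gamma_seq); apply: cvg_nat_infty => A; near=> n.
  have : (A <= n)%N by near: n; exact: nbhs_infty_ge.
  lia.
have -> : 3 + 3 * euler_gamma - ln 2 = (2 - 2 * 0) + 3 * euler_gamma +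
  ((2 - 2 * 0) - (1 - 0)) - ((euler_gamma - euler_gamma) + ln 2) :> R by ring.
apply: cvgB; last by apply: cvgD cvg_ln_double_ratio; exact: cvgB.
apply: cvgD; first by apply: cvgD => //; apply: cvgMr; exact: cvg_gamma_seq.
by apply: cvgB => //; apply: cvgB; [exact: cvg_cst | exact: cvg_inv_double].
Unshelve. all: by end_near. Qed.

Lemma cvg_ln_half : (fun n => ln (n./2%:R : R) - ln n%:R) @ \oo --> (- ln 2 : R).
Proof.
(* The sequence below is the quotient of [n] by [n./2]. *)
have c2 : (fun n => 2 + (odd n)%:R * n./2%:R^-1 : R) @ \oo --> (2 : R).
  rewrite -[X in _ --> X]addr0; apply: cvgD; first exact: cvg_cst.
  apply: (@squeeze_cvgr _ _ _ _ (fun=> 0) (fun n => 4 * n.+1%:R^-1)).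
  - near=> n; have n0 : (1 < n)%N by near: n; exact: nbhs_infty_gt.
    have h0 : (0 < n./2)%N by rewrite half_gt0.
    rewrite mulr_ge0 ?invr_ge0//=; apply: (@le_trans _ _ (n./2%:R^-1)).
      by rewrite ler_piMl ?invr_ge0// lern1 leq_b1.
    rewrite ler_pdivlMr ?ltr0n// mulrC ler_pdivrMr ?ltr0n// -natrM ler_nat.
    by have := odd_double_half n; case: (odd n) => /=; lia.
  - exact: cvg_cst.
  - rewrite -[X in _ --> X](mulr0 4); apply: cvgMr; exact: cvg_invn.
have : (fun n => - ln (2 + (odd n)%:R * n./2%:R^-1 : R)) @ \oo --> (- ln 2 : R).
  by apply: cvgN; apply: continuous_cvg c2; exact: continuous_ln.
apply: cvg_trans; apply: near_eq_cvg; near=> n.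
have n0 : (1 < n)%N by near: n; exact: nbhs_infty_gt.
have h0 : (0 < n./2)%N by rewrite half_gt0.
have h0' : n./2%:R != 0 :> R by rewrite pnatr_eq0 -lt0n.
have -> : 2 + (odd n)%:R * n./2%:R^-1 = n%:R / n./2%:R :> R.
  have -> : n%:R = (odd n)%:R + 2 * n./2%:R :> R.
    by rewrite -{1}(odd_double_half n) natrD -mul2n natrM.
  by field.
by rewrite ln_div ?posrE ?ltr0n ?(ltnW n0)// opprB.
Unshelve. all: by end_near. Qed.

End RealLimits.

(** * Barnes products and cross factors *)

Section BarnesProduct.
Context {R : realType}.
Implicit Types z w : R[i].

Lemma near_one_weierstrass_inv z :
  near_one 3 (fun n => (1 + z / n%:R) * cexp (- (z / n%:R) + (z / n%:R) ^+ 2 / 2)).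
Proof.
apply: (near_one_weierstrass (B := cabs z)); apply: nearW => n.
by rewrite cabsM cabsV cabs_nat.
Qed.

Definition barnes_term z (k : nat) : R[i] :=
  (1 + z / k%:R) ^+ k * cexp (- z + z ^+ 2 / (2 * k%:R)).

Lemma near_one_barnes_term z : near_one 2 (barnes_term z).
Proof.
apply: near_one_ext (near_one_expn (near_one_weierstrass_inv z)); near=> n.
have n0 : n%:R != 0 :> R[i] by rewrite natC_neq0//; near: n; exact: nbhs_infty_gt.
rewrite exprMn -cexpMn /barnes_term; congr (_ * cexp _).
by rewrite -[_ *+ n]mulr_natr; field.
Unshelve. all: by end_near. Qed.

(** The factor of index [k] is the [k]-th power of a quantity [1 + O(1 / k ^ 3)], so
the product converges, and its limit has no zeros besides those of the factors. *)
Lemma barnes_limit z : exists l : R[i]^o,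
  [/\ (fun n => \prod_(1 <= k < n.+1) barnes_term z k : R[i]^o) @ \oo --> l,
  barnesG (1 + z) = rpowc (2 * pi) (z / 2) *
    cexp (- ((z + 1) * z / 2) - euler_gamma%:C * z ^+ 2 / 2) * l &
  (forall k, (0 < k)%N -> 1 + z / k%:R != 0) -> l != 0].
Proof.
have [l hl] := near_one2_cvg (near_one_barnes_term z).
exists l; split => //.
  have -> : barnesG (1 + z) = barnesG1p z by rewrite /barnesG addrAC subrr add0r.
  rewrite /barnesG1p; congr (_ * _); exact: (cvg_lim (@norm_hausdorff _ R[i]^o) hl).
move=> h; apply: (near_one2_cvg_neq0 (near_one_barnes_term z) _ hl) => k k0.
by rewrite /barnes_term mulf_neq0 ?expf_neq0 ?cexp_neq0 ?h.
Qed.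

End BarnesProduct.

Section CrossFactors.
Context {R : realType}.
Context (beta : R[i]) (betaNint : forall m : int, beta <> m%:~R).

(** Otherwise every tail of the sine product would be zero, whereas the tails
tend to one. *)
Lemma sinpi_over_pi_neq0 : sinpi_over_pi beta != 0.
Proof.
apply/eqP => c0; have := near_one_cvg (near_one_weaken (leqnSn 1) (near_one_sine_tail betaNint)).
move=> h; have [N _ /(_ N (leqnn N))] := (cvgrPdist_lt _ _).1 h 1 ltr01.
by rewrite /= /sine_tail c0 !mul0r subr0 normr1 ltxx.
Qed.

(** The cross factor is a quotient of three factors [1 + z / n], with [z] equal to
[- 2 beta] and twice to [- beta]; the exponentials that make each of them
[1 + O(1 / n ^ 3)] combine into [exp (beta ^ 2 / n ^ 2)]. *)
Lemma near_one_cross3 : near_one 3 (fun m => cross_factor beta m * cexp (beta ^+ 2 / m%:R ^+ 2)).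
Proof.
have h1 := near_one_weierstrass_inv (- (2 * beta)).
have h2 := near_oneV (ltn0Sn 2) (near_one_weierstrass_inv (- beta)).
apply: near_one_ext (near_oneM h1 (near_oneM h2 h2)); near=> n.
have n0 : n%:R != 0 :> R[i] by rewrite natC_neq0//; near: n; exact: nbhs_infty_gt.
have [h _] := beta_nat_neq0 betaNint n.
have -> : cexp (beta ^+ 2 / n%:R ^+ 2) =
   cexp (- (- (2 * beta) / n%:R) + (- (2 * beta) / n%:R) ^+ 2 / 2) *
   (cexp (- (- (- beta / n%:R) + (- beta / n%:R) ^+ 2 / 2)) *
    cexp (- (- (- beta / n%:R) + (- beta / n%:R) ^+ 2 / 2))).
  by rewrite -!cexpD; congr cexp; field.
rewrite /cross_factor !invfM -!cexpN !mulNr.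
set A := cexp _; set B := cexp (- _); move: A B => A B.
by ring.
Unshelve. all: by end_near. Qed.

Definition cross_norm m : R[i] := cross_factor beta m * cexp (beta ^+ 2 / (m%:R * m.+1%:R)).

Lemma near_one_cross_norm : near_one 3 cross_norm.
Proof.
have h : near_one 3 (fun m => cexp (beta ^+ 2 / (m%:R * m.+1%:R) - beta ^+ 2 / m%:R ^+ 2)).
  apply: (near_one_cexp (B := cabs beta ^+ 2)); near=> n.
  have n0 : (0 < n)%N by near: n; exact: nbhs_infty_gt.
  have n1 : n%:R != 0 :> R[i] by rewrite natC_neq0.
  have n2 : n.+1%:R != 0 :> R[i] by rewrite natC_neq0.
  have -> : beta ^+ 2 / (n%:R * n.+1%:R) - beta ^+ 2 / n%:R ^+ 2 =
     - (beta ^+ 2 / (n%:R ^+ 2 * n.+1%:R)).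
    by rewrite -natr1 in n2 *; field; rewrite n1 n2.
  rewrite cabsN cabsM cabsX cabsV cabsM cabsX !cabs_nat.
  rewrite ler_wpM2l ?exprn_ge0 ?cabs_ge0// lef_pV2 ?posrE ?mulr_gt0 ?exprn_gt0 ?ltr0n//.
  by rewrite [leLHS]exprSr ler_wpM2l ?exprn_ge0// ler_nat.
apply: near_one_ext (near_oneM near_one_cross3 h); near=> n.
by rewrite -mulrA -cexpD addrC addrNK.
Unshelve. all: by end_near. Qed.

Lemma near_one_cross2 : near_one 2 (cross_factor beta).
Proof.
have h : near_one 2 (fun m => cexp (- (beta ^+ 2 / m%:R ^+ 2))).
  apply: (near_one_cexp (B := cabs beta ^+ 2)); apply: nearW => n.
  by rewrite cabsN cabsM cabsX cabsV cabsX cabs_nat.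
apply: near_one_ext (near_oneM (near_one_weaken (leqnSn 2) near_one_cross3) h).
by apply: nearW => n; rewrite -mulrA -cexpD subrr cexp0 mulr1.
Qed.

(** About [N] factors, raised to powers at most [N], each [1 + O(1 / N ^ 3)]. *)
Lemma near_one_cross_norm_prod : near_one 1 (fun N =>
  \prod_(N.+1 <= m < N.*2.+1) cross_norm m ^+ (N.*2 - m)).
Proof.
have [C [C0 [n0 _ hC]]] := near_oneP near_one_cross_norm.
apply: (near_one_prod (C := C * expR C)).
  by move=> n; rewrite size_iota; lia.
near=> n => m; rewrite mem_index_iota => /andP[m1 m2].
have np : (0 < n)%N by near: n; exact: nbhs_infty_gt.
have n0n : (n0 <= n)%N by near: n; exact: nbhs_infty_ge.
have npR : 0 < n%:R :> R by rewrite ltr0n.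
have hm : cabs (cross_norm m - 1) <= C / n%:R ^+ 3.
  apply: (le_trans (hC m _)); first by rewrite /= (leq_trans n0n)// ltnW.
  rewrite ler_wpM2l// lef_pV2 ?posrE ?exprn_gt0 ?ltr0n//; last by lia.
  by rewrite lerXn2r ?nnegrE// ler_nat ltnW.
have hs : (n.*2 - m)%:R * cabs (cross_norm m - 1) <= C / n%:R ^+ 2.
  have -> : C / n%:R ^+ 2 = n%:R * (C / n%:R ^+ 3) by field; rewrite gt_eqF.
  by apply: ler_pM; rewrite ?cabs_ge0// ler_nat; lia.
have s0 : 0 <= (n.*2 - m)%:R * cabs (cross_norm m - 1) by rewrite mulr_ge0 ?cabs_ge0.
have hs' : (n.*2 - m)%:R * cabs (cross_norm m - 1) <= C.
  by rewrite (le_trans hs)// ler_pdivrMr ?exprn_gt0// ler_peMr// exprn_ege1// ler1n.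
apply: (le_trans (cabs_exp_sub1_le _ _)); apply: (le_trans (expR_sub1_le s0)).
by rewrite [leRHS]mulrAC; apply: ler_pM; rewrite ?expR_ge0 ?ler_expR.
Unshelve. all: by end_near. Qed.

Lemma near_one_cross_prod : near_one 1 (fun N =>
  \prod_(N.+1 <= m < N.*2.+1) cross_factor beta m).
Proof.
have [C [C0 [n0 _ hC]]] := near_oneP near_one_cross2.
apply: (near_one_prod (C := C)).
  by move=> n; rewrite size_iota; lia.
near=> n => m; rewrite mem_index_iota => /andP[m1 m2].
have np : (0 < n)%N by near: n; exact: nbhs_infty_gt.
have n0n : (n0 <= n)%N by near: n; exact: nbhs_infty_ge.
apply: (le_trans (hC m _)); first by rewrite /= (leq_trans n0n)// ltnW.
rewrite ler_wpM2l// lef_pV2 ?posrE ?exprn_gt0 ?ltr0n//; last by lia.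
by rewrite lerXn2r ?nnegrE// ler_nat ltnW.
Unshelve. all: by end_near. Qed.

End CrossFactors.

(** * Asymptotics of the determinant *)

Section Assembly.
Context {R : realType}.

Lemma cvg_cexp_real (w : R[i]) (x : nat -> R) (a : R) : x @ \oo --> a ->
  (fun n => cexp (w * (x n)%:C) : R[i]^o) @ \oo --> (cexp (w * a%:C) : R[i]^o).
Proof.
move=> hx; case: w => p q.
have hp : (fun n => p * x n) @ \oo --> p * a by apply: cvgMr.
have hq : (fun n => q * x n) @ \oo --> q * a by apply: cvgMr.
have he : (fun n => expR (p * x n)) @ \oo --> expR (p * a).
  by apply: continuous_cvg hp; exact: continuous_expR.
have e (y : R) : cexp ((p +i* q) * y%:C) =
    (expR (p * y) * cos (q * y)) +i* (expR (p * y) * sin (q * y)).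
  by rewrite /cexp /= !mulr0 subr0 add0r.
under eq_fun do rewrite e.
rewrite e; apply: cvg_ReIm => /=; apply: (cvgM he).
  by apply: continuous_cvg hq; exact: continuous_cos.
by apply: continuous_cvg hq; exact: continuous_sin.
Qed.

Lemma cvg_odd_case (u : nat -> R[i]^o) : u @ \oo --> (1 : R[i]^o) ->
  (fun n => if odd n then u n else 1 : R[i]^o) @ \oo --> (1 : R[i]^o).
Proof.
move=> h; apply/cvgrPdist_lt => e e0; near=> n.
case: ifP => _; last by rewrite subrr normr0.
near: n; exact: (cvgrPdist_lt _ _).1 h e e0.
Unshelve. all: by end_near. Qed.

Lemma cvg_mul1C (u v : nat -> R[i]^o) (l : R[i]^o) : u @ \oo --> (1 : R[i]^o) ->
  v @ \oo --> l -> (fun n => u n * v n : R[i]^o) @ \oo --> l.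
Proof.
move=> hu hv; apply: (eq_ind _ (fun x : R[i]^o => _ @ \oo --> x) _ _ (mul1r l)).
exact: (cvgM hu hv).
Qed.

Lemma cvg_sqrC (u : nat -> R[i]^o) (l : R[i]^o) : u @ \oo --> l ->
  (fun n => u n ^+ 2 : R[i]^o) @ \oo --> (l ^+ 2 : R[i]^o).
Proof. by move=> h; exact: (cvgM h h). Qed.

Context (beta : R[i]) (betaNint : forall m : int, beta <> m%:~R).
Local Notation D n := (\det (M n (phi2 beta))).

Local Notation barnes_prod z N := (\prod_(1 <= k < N.+1) barnes_term z k).
Local Notation cross_norm_prod N :=
  (\prod_(N.+1 <= m < N.*2.+1) cross_norm beta m ^+ (N.*2 - m)).
Local Notation tail_norm N := (sine_tail beta N * cexp (beta ^+ 2 / N.+1%:R)).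

(** The exponentials of the Barnes factors at [- 2 beta] and, twice, at [beta]
have linear parts that cancel: what remains is [exp (- 3 beta ^ 2 / m)]. *)
Lemma prod_barnes_factor N : \prod_(1 <= m < N.+1) barnes_factor beta m ^+ m =
  barnes_prod (- (2 * beta)) N * barnes_prod beta N ^+ 2 *
  cexp (- beta ^+ 2 * (3 * \sum_(1 <= k < N.+1) k%:R^-1)%:C).
Proof.
have -> : (3 * \sum_(1 <= k < N.+1) k%:R^-1)%:C = \sum_(1 <= k < N.+1) 3 / k%:R :> R[i].
  rewrite rmorphM rmorph_nat rmorph_sum mulr_sumr.
  by apply: eq_bigr => k _; rewrite fmorphV rmorph_nat.
rewrite mulr_sumr cexp_sum.
rewrite -prodrXl -!big_split big_nat_cond [RHS]big_nat_cond /=.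
apply: eq_bigr => m; rewrite andbT => /andP[m0 _].
have m0' := natC_neq0 (R := R) m0.
rewrite /barnes_factor /barnes_term.
have -> : cexp (- beta ^+ 2 * (3 / m%:R)) = cexp (- (- - (2 * beta) + (- (2 * beta)) ^+ 2 / (2 * m%:R))) *
    (cexp (- (- beta + beta ^+ 2 / (2 * m%:R)))) ^+ 2.
  by rewrite -cexpMn -cexpD; congr cexp; rewrite mulr2n; field.
rewrite !cexpN.
have := cexp_neq0 (- - (2 * beta) + (- (2 * beta)) ^+ 2 / (2 * m%:R)).
have := cexp_neq0 (- beta + beta ^+ 2 / (2 * m%:R)).
move: (cexp _) => A A0; move: (cexp _) => B B0.
rewrite !exprMn -!exprM mulnC mulNr mul2n -addnn exprD.
move: ((1 - _) ^+ m) => x; move: ((1 + _) ^+ m) => y.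
by field; rewrite A0 B0.
Qed.

Lemma prod_cross_factor N :
  \prod_(N.+1 <= m < N.*2.+1) cross_factor beta m ^+ (N.*2 - m) =
  cross_norm_prod N * cexp (- beta ^+ 2 * (weight_sum N)%:C).
Proof.
have -> : (weight_sum N)%:C =
    \sum_(N.+1 <= m < N.*2.+1) (N.*2 - m)%:R / (m%:R * m.+1%:R) :> R[i].
  rewrite rmorph_sum; apply: eq_bigr => k _.
  by rewrite rmorphM fmorphV rmorphM !rmorph_nat.
rewrite mulr_sumr cexp_sum -big_split /=.
rewrite big_nat_cond [RHS]big_nat_cond.
apply: eq_bigr => m; rewrite andbT => /andP[m1 m2].
have m0 : m%:R != 0 :> R[i] by rewrite natC_neq0//; lia.
have m0' : m.+1%:R != 0 :> R[i] by rewrite natC_neq0.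
rewrite /cross_norm [(_ * cexp _) ^+ _]exprMn -cexpMn -mulrA -cexpD.
have -> : (beta ^+ 2 / (m%:R * m.+1%:R)) *+ (N.*2 - m) +
  - beta ^+ 2 * ((N.*2 - m)%:R / (m%:R * m.+1%:R)) = 0; last by rewrite cexp0 mulr1.
rewrite -[_ *+ (_ - _)]mulr_natr; ring.
Qed.

Lemma det_M_phi2_normal N : D N.*2 =
  tail_norm N ^+ N.*2 * cross_norm_prod N *
  (barnes_prod (- (2 * beta)) N * barnes_prod beta N ^+ 2) *
  cexp (- beta ^+ 2 * (exponent_seq N)%:C) * rpowc N%:R (- (3 * beta ^+ 2)).
Proof.
rewrite det_M_phi2_double// prod_barnes_factor prod_cross_factor.
rewrite [(sine_tail beta N * cexp _) ^+ _]exprMn -cexpMn.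
set A := sine_tail _ _ ^+ _; set P := _ * _ ^+ 2.
have -> : cexp ((beta ^+ 2 / N.+1%:R) *+ N.*2) =
    cexp (- (- beta ^+ 2 * (N.*2%:R / N.+1%:R)%:C)).
  by congr cexp; rewrite rmorphM fmorphV !rmorph_nat -[_ *+ N.*2]mulr_natr; ring.
have -> : cexp (- beta ^+ 2 * (exponent_seq N)%:C) =
   cexp (- beta ^+ 2 * (N.*2%:R / N.+1%:R)%:C) *
   (cexp (- beta ^+ 2 * (3 * \sum_(1 <= k < N.+1) k%:R^-1)%:C) *
    (cexp (- beta ^+ 2 * (weight_sum N)%:C) *
     cexp (- (- beta ^+ 2 * (3 * ln N%:R)%:C)))).
  by rewrite -!cexpD; congr cexp; rewrite /exponent_seq rmorphB !rmorphD /=; ring.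
have -> : rpowc N%:R (- (3 * beta ^+ 2)) = cexp (- beta ^+ 2 * (3 * ln N%:R)%:C).
  by rewrite /rpowc; congr cexp; rewrite rmorphM rmorph_nat; ring.
rewrite !cexpN.
have := cexp_neq0 (- beta ^+ 2 * (3 * ln N%:R)%:C).
have := cexp_neq0 (- beta ^+ 2 * (N.*2%:R / N.+1%:R)%:C).
set a := cexp _; set b := cexp _; set d := cexp _; set e := cexp _.
clearbody A P a b d e; move=> a0 b0; move: (\prod_(_ <= _ < _) _) => Q.
by field; rewrite a0 b0.
Qed.

Definition border_odd N := sine_tail beta N *
  \prod_(N.+1 <= m < N.*2.+1) cross_factor beta m.

Lemma cvg_border_odd : (border_odd : nat -> R[i]^o) @ \oo --> (1 : R[i]^o).
Proof.
apply: near_one_cvg.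
have h : near_one 1 (fun N => cexp (- (beta ^+ 2 / N.+1%:R))).
  apply: (near_one_cexp (B := cabs beta ^+ 2)); near=> n.
  rewrite cabsN cabsM cabsX cabsV cabs_nat expr1 ler_wpM2l ?exprn_ge0 ?cabs_ge0//.
  by rewrite lef_pV2 ?posrE ?ltr0n ?ler_nat//; near: n; exact: nbhs_infty_gt.
have t := near_oneM (near_one_weaken (leqnSn 1) (near_one_sine_tail betaNint)) h.
apply: near_one_ext (near_oneM t (near_one_cross_prod betaNint)).
by apply: nearW => n; rewrite -[_ * _ * cexp (- _)]mulrA -cexpD subrr cexp0 mulr1.
Unshelve. all: by end_near. Qed.

(** The determinant divided by [n ^ (- 3 beta ^ 2)], as a product of convergent
factors in [N = n / 2]; the last one accounts for the ratio of [n] to [N]. *)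
Definition normalized_det n : R[i] :=
  (if odd n then border_odd n./2 else 1) *
  (tail_norm n./2 ^+ n./2.*2 * cross_norm_prod n./2 *
  (barnes_prod (- (2 * beta)) n./2 * barnes_prod beta n./2 ^+ 2) *
  cexp (- beta ^+ 2 * (exponent_seq n./2)%:C) *
  cexp (- (3 * beta ^+ 2) * (ln n./2%:R - ln n%:R)%:C)).

Lemma det_M_phi2_normalized n :
  D n = rpowc n%:R (- (3 * beta ^+ 2)) * normalized_det n.
Proof.
have -> : D n = (if odd n then border_odd n./2 else 1) * D n./2.*2.
  have := odd_double_half n; case: (odd n) => /= e; last by rewrite add0n in e; rewrite mul1r e.
  have DS N : D N.*2.+1 = border_odd N * D N.*2 by rewrite det_M_phi2_S// doubleK.
  by rewrite -DS; rewrite add1n in e; rewrite e.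
rewrite det_M_phi2_normal /normalized_det.
have -> : rpowc n./2%:R (- (3 * beta ^+ 2)) = rpowc n%:R (- (3 * beta ^+ 2)) *
    cexp (- (3 * beta ^+ 2) * (ln n./2%:R - ln n%:R)%:C).
  by rewrite /rpowc -cexpD; congr cexp; rewrite rmorphB /=; ring.
move: (if _ then _ else _) (rpowc _ _) (_ ^+ _ * _) (_ * _ ^+ 2) => o r u v.
by ring.
Qed.

Lemma cvg_normalized_det (l1 l2 : R[i]^o) :
  (fun n => barnes_prod (- (2 * beta)) n : R[i]^o) @ \oo --> l1 ->
  (fun n => barnes_prod beta n : R[i]^o) @ \oo --> l2 ->
  (normalized_det : nat -> R[i]^o) @ \oo --> (l1 * l2 ^+ 2 *
    cexp (- beta ^+ 2 * (3 + 3 * euler_gamma - ln 2)%:C) *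
    cexp (- (3 * beta ^+ 2) * (- ln 2)%:C) : R[i]^o).
Proof.
move=> h1 h2.
have ht : (fun N => tail_norm N ^+ N.*2 : R[i]^o) @ \oo --> (1 : R[i]^o).
  apply: near_one_cvg; have := near_one_expn (near_one_sine_tail betaNint).
  move=> h; apply: near_one_ext (near_oneM h h); apply: nearW => n.
  by rewrite -exprD addnn.
have hq := near_one_cvg (near_one_cross_norm_prod betaNint).
have he := cvg_cexp_real (w := - beta ^+ 2) (@cvg_exponent_seq R).
have hl := cvg_cexp_real (w := - (3 * beta ^+ 2)) (@cvg_ln_half R).
have ho : (fun n => if odd n then border_odd n./2 else 1 : R[i]^o) @ \oo --> (1 : R[i]^o).
  by apply: cvg_odd_case; exact: (cvg_comp _ _ cvg_half cvg_border_odd).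
have h2' : (fun n => barnes_prod beta n ^+ 2 : R[i]^o) @ \oo --> (l2 ^+ 2 : R[i]^o).
  exact: cvg_sqrC h2.
have hN : (fun N => tail_norm N ^+ N.*2 * cross_norm_prod N *
    (barnes_prod (- (2 * beta)) N * barnes_prod beta N ^+ 2) *
    cexp (- beta ^+ 2 * (exponent_seq N)%:C) : R[i]^o) @ \oo -->
    (l1 * l2 ^+ 2 *
    cexp (- beta ^+ 2 * (3 + 3 * euler_gamma - ln 2)%:C) : R[i]^o).
  apply: (cvgM _ he); apply: cvg_mul1C; last exact: (cvgM h1 h2').
  exact: (cvg_mul1C ht hq).
have hN' := cvg_comp _ _ cvg_half hN.
exact: (cvg_mul1C ho (cvgM hN' hl)).
Qed.

(** The constants in front of the three Barnes products: the powers of [2 pi]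
cancel, and the exponents [- (z + 1) z / 2 - gamma z ^ 2 / 2] add up to
[- 3 beta ^ 2 (1 + gamma)]. *)
Lemma barnes_constant (l1 l2 : R[i]) :
  barnesG (1 + - (2 * beta)) = rpowc (2 * pi) (- (2 * beta) / 2) *
    cexp (- ((- (2 * beta) + 1) * - (2 * beta) / 2) -
      euler_gamma%:C * (- (2 * beta)) ^+ 2 / 2) * l1 ->
  barnesG (1 + beta) = rpowc (2 * pi) (beta / 2) *
    cexp (- ((beta + 1) * beta / 2) - euler_gamma%:C * beta ^+ 2 / 2) * l2 ->
  l1 * l2 ^+ 2 * cexp (- beta ^+ 2 * (3 + 3 * euler_gamma - ln 2)%:C) *
    cexp (- (3 * beta ^+ 2) * (- ln 2)%:C) =
  rpowc 2 (4 * beta ^+ 2) * barnesG (1 - 2 * beta) * barnesG (1 + beta) ^+ 2.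
Proof.
move=> -> ->; rewrite /rpowc.
set a := cexp _; set b := cexp _; set p := cexp _; set q := cexp _; set r := cexp _.
set s := cexp _; set t := cexp _.
suff e : a * b = p * q * r * (s * t) ^+ 2.
  transitivity (l1 * l2 ^+ 2 * (a * b)); first by ring.
  by rewrite e; ring.
rewrite /a /b /p /q /r /s /t -!cexpD -cexpMn -!cexpD; congr cexp.
rewrite mulr2n rmorphN rmorphB rmorphD rmorphM !rmorph_nat /=.
by field.
Qed.

End Assembly.

Section Conclusion.
Context {R : realType}.

Lemma cvg_div_sub1 (u : nat -> R[i]^o) (l : R[i]) : l != 0 ->
  u @ \oo --> (l : R[i]^o) -> (fun n => u n / l - 1 : R[i]^o) @ \oo --> (0 : R[i]^o).
Proof.
move=> l0 h; apply/subr_cvg0.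
apply: (eq_ind _ (fun x : R[i]^o => _ @ \oo --> x) _ _ (divff l0)).
exact: (cvgM h (cvg_cst (l^-1 : R[i]^o))).
Qed.

Context (beta : R[i]) (betaNint : forall m : int, beta <> m%:~R).
Local Notation D n := (\det (M n (phi2 beta))).

(** If the limit [K0] of the normalised determinant is nonzero, the quotient by it
tends to one; if it is zero, a factor [1 - 2 beta / k] vanishes, and with it all
determinants of size larger than [k]. *)
Lemma det_M_phi2_asymp :
  asymp (fun n : nat => D n)
        (fun n : nat => rpowc n%:R (- (3 * beta ^+ 2)) * rpowc 2 (4 * beta ^+ 2) *
                        barnesG (1 - 2 * beta) * barnesG (1 + beta) ^+ 2).
Proof.
have [l1 [h1 G1 n1]] := barnes_limit (- (2 * beta)).
have [l2 [h2 G2 n2]] := barnes_limit beta.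
have K := barnes_constant G1 G2.
have hX := cvg_normalized_det betaNint h1 h2.
set K0 := rpowc 2 _ * _ * _ in K; rewrite K in hX.
have {}n2 : l2 != 0.
  apply: n2 => k k0; have [_ h] := beta_nat_neq0 betaNint k.
  have k0' := natC_neq0 (R := R) k0.
  have -> : 1 + beta / k%:R = (k%:R + beta) / k%:R by field.
  by rewrite mulf_neq0// invr_neq0.
have cE n : rpowc n%:R (- (3 * beta ^+ 2)) * rpowc 2 (4 * beta ^+ 2) *
     barnesG (1 - 2 * beta) * barnesG (1 + beta) ^+ 2 =
     rpowc n%:R (- (3 * beta ^+ 2)) * K0 by rewrite /K0 !mulrA.
have [l10|l10] := eqVneq l1 0.
  have [k [k0 ek]] : exists k, (0 < k)%N /\ 2 * beta = k%:R.
    apply/not_existsP => h; move/eqP: l10; apply/negP; apply: n1 => k k0.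
    rewrite mulNr subr_eq0; apply/eqP => e; apply: (h k); split => //.
    by rewrite -[LHS](divfK (natC_neq0 k0)) -e mul1r.
  exists (fun=> 0); split; first exact: cvg_cst.
  near=> n.
  have nk : (k < n)%N by near: n; exact: nbhs_infty_gt.
  have -> : D n = 0.
    by apply/det_M_phi2_eq0 => //; [exact: sinpi_over_pi_neq0 | exists k; rewrite k0 nk].
  by rewrite cE -K l10 !mul0r mulr0 mul0r.
have K00 : K0 != 0.
  rewrite -K; apply: mulf_neq0 (cexp_neq0 _); apply: mulf_neq0 (cexp_neq0 _).
  by apply: mulf_neq0 l10 _; exact: expf_neq0.
exists (fun n => normalized_det beta n / K0 - 1); split; last first.
  apply: nearW => n; rewrite det_M_phi2_normalized//.
  by rewrite cE addrCA subrr addr0 -mulrA; congr (_ * _); rewrite mulrC divfK.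
exact: cvg_div_sub1 K00 hX.
Unshelve. all: by end_near. Qed.

Lemma det_M_phi2_zero n : D n = 0 <->
  (exists m : nat, beta = m%:R + 1 / 2) /\ 2 * beta + 1 <= n%:R.
Proof.
rewrite (det_M_phi2_eq0 betaNint n (sinpi_over_pi_neq0 betaNint)).
have two0 : 2 != 0 :> R[i] by rewrite pnatr_eq0.
split.
  move=> [m [/andP[m0 mn] e]]; split; last by rewrite e natr1 ler_nat.
  have bE : beta = m%:R / 2 by rewrite -e mulrAC divff// mul1r.
  have := odd_double_half m; case: (odd m) => /= em; last first.
    exfalso; apply: (betaNint (m := m./2%:Z)); rewrite bE.
    have -> : m%:R = 2 * m./2%:R :> R[i] by rewrite -[in LHS]em add0n -mul2n natrM.
    by rewrite mulrAC divff// mul1r.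
  exists m./2; rewrite bE.
  have -> : m%:R = 1 + 2 * m./2%:R :> R[i] by rewrite -[in LHS]em natrD -mul2n natrM.
  by field.
move=> [[m ->]].
have -> : 2 * (m%:R + 1 / 2) + 1 = (m.*2.+2)%:R :> R[i].
  by rewrite -doubleS -mul2n natrM -natr1; field.
rewrite ler_nat => h; exists m.*2.+1; split; first lia.
have -> : m.*2.+1%:R = 2 * m%:R + 1 :> R[i] by rewrite -[LHS]natr1 -mul2n natrM.
by field.
Qed.

End Conclusion.

Theorem theorem7p4 (R : realType) (beta : R[i])
    (hbeta : forall m : int, beta <> m%:~R) :
  asymp (fun n : nat => \det (M n (phi2 beta)))
        (fun n : nat => rpowc n%:R (- (3 * beta ^+ 2)) * rpowc 2 (4 * beta ^+ 2) *
                        barnesG (1 - 2 * beta) * barnesG (1 + beta) ^+ 2)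
  /\
  (forall n : nat, \det (M n (phi2 beta)) = 0 <->
     (exists m : nat, beta = m%:R + 1 / 2) /\ 2 * beta + 1 <= n%:R).
Proof.
by split; [exact: det_M_phi2_asymp | exact: det_M_phi2_zero].
Qed.
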